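(* Let $n, m$ be nonnegative integers, let $\tau > 0$, let $a_0, \dots, a_{n-1}, \alpha_0, \dots, \alpha_m$ be real numbers, and let $\Delta : \mathbb{C} \to \mathbb{C}$ be the quasipolynomial $$\Delta(s) = s^n + \sum_{k=0}^{n-1} a_k s^k + e^{-s\tau} \sum_{k=0}^m \alpha_k s^k .$$ Let $s_0 \in \mathbb{R}$. Let $P$ and $Q$ be the polynomials $$P(s) = s^n + \sum_{k=0}^{n-1} a_k s^k, \qquad Q(s) = \sum_{k=0}^m \alpha_k s^k,$$ and define, for $z \in \mathbb{C}$, $$\widetilde\Delta(z) = \tau^n \Delta\left(s_0 + \tfrac{z}{\tau}\right), \qquad \widetilde P(z) = \tau^n P\left(s_0 + \tfrac{z}{\tau}\right), \qquad \widetilde Q(z) = e^{-s_0 \tau} \tau^n Q\left(s_0 + \tfrac{z}{\tau}\right).$$ Then the following assertions are equivalent. (a) The real number $s_0$ is a root of multiplicity $n + m + 1$ of $\Delta$. (b) The pair of polynomials $(-\widetilde Q, \widetilde P)$ is a Padé approximation of order $(m, n)$ of the exponential function $z \mapsto e^z$. (c) For every $z \in \mathbb{C}$, $$\widetilde\Delta(z) = \frac{n!\, z^{n + m + 1}}{(n + m + 1)!}\, \Phi(m + 1, n + m + 2, -z).$$ (d) The coefficients $a_0, \dots, a_{n-1}, \alpha_0, \dots, \alpha_m$ are given by $$a_k = (-1)^{n-k}\, n! \sum_{j=k}^{n} \frac{\binom{j}{k} \binom{m+n-j}{m} s_0^{j-k}}{j!\, \tau^{n-j}} \qquad \text{for every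 integer } k \text{ with } 0 \le k \le n-1,$$ $$\alpha_k = (-1)^{n-1} e^{s_0 \tau} \sum_{j=k}^{m} \frac{(-1)^{j-k} (m+n-j)!\, s_0^{j-k}}{k!\, (j-k)!\, (m-j)!\, \tau^{n-j}} \qquad \text{for every integer } k \text{ with } 0 \le k \le m.$$ In addition, if these equivalent assertions are satisfied and $m \leq n$, then $s_0$ is the rightmost root of $\Delta$, i.e., $\Re(s) \leq \Re(s_0)$ for every $s \in \mathbb{C}$ such that $\Delta(s) = 0$.
   Context: Padé approximation: let $f : U \to \mathbb{C}$ be analytic on a neighborhood $U \subset \mathbb{C}$ of $0$, and let $m, n$ be nonnegative integers. A pair of polynomials $(A, B)$ with $\deg A \leq m$ and $\deg B \leq n$ is a Padé approximation of $f$ of order $(m, n)$ if $B(z) f(z) - A(z) = O(z^{n+m+1})$ as $z \to 0$. (The first entry of the pair is the numerator and the second is the denominator.) Kummer confluent hypergeometric function: for $a, b \in \mathbb{C}$ with $b$ not a nonpositive integer, $\Phi(a, b, \cdot) : \mathbb{C} \to \mathbb{C}$ is the entire function $$\Phi(a, b, z) = \sum_{k=0}^{\infty} \frac{(a)_k}{(b)_k} \frac{z^k}{k!},$$ where $(\alpha)_k$ is the ascending factorial, defined by $(\alpha)_0 = 1$ and $(\alpha)_{k+1} = (\alpha + k)(\alpha)_k$. The multiplicity of a root of $\Delta$ is its order as a zero of the entire function $\Delta$. $\Re(s)$ denotes the real part of $s$. Convention: $s_0^0 = 1$, including when $s_0 = 0$. *)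

(* Defs.v *)
From HB Require Import structures.
From mathcomp Require Import all_boot all_order all_algebra.
From mathcomp Require Import all_classical all_reals all_analysis.
From mathcomp Require Import complex.

Set Implicit Arguments.
Unset Strict Implicit.
Unset Printing Implicit Defensive.

Import Order.TTheory GRing.Theory Num.Theory.
Import numFieldNormedType.Exports.

Local Open Scope ring_scope.
Local Open Scope complex_scope.

(* The norm topology of the field R[i], so that limits, derivatives and Landau *)
(* notations on R[i] are the complex ones.                                     *)
HB.instance Definition _ (R : rcfType) := NormedModule.copy R[i] (R[i]^o).

Definition cexp (R : realType) (z : R[i]) : R[i] :=
  (expR (complex.Re z))%:C * (cos (complex.Im z) +i* sin (complex.Im z)).

(* The order of z0 as a zero of f, for f holomorphic near z0: derive1n is then *)
(* the iterated complex derivative (it is a total operator, whose values are   *)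
(* meaningless where the derivative does not exist).                           *)
Definition zero_of_order (R : realType) (f : R[i] -> R[i]) (z0 : R[i])
    (N : nat) : Prop :=
  (forall k, (k < N)%N -> derive1n k f z0 = 0) /\ derive1n N f z0 != 0.

Definition is_pade (R : realType) (m n : nat) (f : R[i] -> R[i])
    (A B : {poly R[i]}) : Prop :=
  [/\ (size A <= m.+1)%N,
      (size B <= n.+1)%N
    & (fun z : R[i] => B.[z] * f z - A.[z])
        =O_ (0 : R[i]) (fun z : R[i] => z ^+ (n + m + 1))].

Fixpoint ascfact (R : nzRingType) (x : R) (k : nat) : R :=
  if k is k'.+1 then (x + k'%:R) * ascfact x k' else 1.

(* Meaningful only when b is not a nonpositive integer. *)
Definition kummer (R : realType) (a b z : R[i]) : R[i] :=
  limn (series (fun k : nat =>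
    ascfact a k / ascfact b k * (z ^+ k / k`!%:R) : R[i])).

Definition polyP (R : realType) (n : nat) (a : 'I_n -> R) : {poly R[i]} :=
  'X^n + \sum_(k < n) (a k)%:C *: 'X^k.

Definition polyQ (R : realType) (m : nat) (alpha : 'I_m.+1 -> R) :
    {poly R[i]} :=
  \sum_(k < m.+1) (alpha k)%:C *: 'X^k.

Definition Delta (R : realType) (n m : nat) (tau : R)
    (a : 'I_n -> R) (alpha : 'I_m.+1 -> R) (s : R[i]) : R[i] :=
  s ^+ n + \sum_(k < n) (a k)%:C * s ^+ k
  + cexp (- s * tau%:C) * \sum_(k < m.+1) (alpha k)%:C * s ^+ k.

Definition Deltatilde (R : realType) (n m : nat) (tau s0 : R)
    (a : 'I_n -> R) (alpha : 'I_m.+1 -> R) (z : R[i]) : R[i] :=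
  tau%:C ^+ n * Delta tau a alpha (s0%:C + z / tau%:C).

Definition Ptilde (R : realType) (n : nat) (tau s0 : R) (a : 'I_n -> R) :
    {poly R[i]} :=
  tau%:C ^+ n *: (polyP a \Po (s0%:C%:P + (tau%:C)^-1 *: 'X)).

Definition Qtilde (R : realType) (n m : nat) (tau s0 : R)
    (alpha : 'I_m.+1 -> R) : {poly R[i]} :=
  ((expR (- s0 * tau))%:C * tau%:C ^+ n)
    *: (polyQ alpha \Po (s0%:C%:P + (tau%:C)^-1 *: 'X)).

Lemma horner_Ptilde (R : realType) (n : nat) (tau s0 : R) (a : 'I_n -> R)
    (z : R[i]) :
  (Ptilde tau s0 a).[z] = tau%:C ^+ n * (polyP a).[s0%:C + z / tau%:C].
Proof.
by rewrite hornerZ horner_comp !hornerE [_^-1 * z]mulrC.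
Qed.

Lemma horner_Qtilde (R : realType) (n m : nat) (tau s0 : R)
    (alpha : 'I_m.+1 -> R) (z : R[i]) :
  (Qtilde n tau s0 alpha).[z] =
  (expR (- s0 * tau))%:C * tau%:C ^+ n * (polyQ alpha).[s0%:C + z / tau%:C].
Proof.
by rewrite hornerZ horner_comp !hornerE [_^-1 * z]mulrC.
Qed.

Lemma Delta_polyPQ (R : realType) (n m : nat) (tau : R)
    (a : 'I_n -> R) (alpha : 'I_m.+1 -> R) (s : R[i]) :
  Delta tau a alpha s =
  (polyP a).[s] + cexp (- s * tau%:C) * (polyQ alpha).[s].
Proof.
rewrite /Delta /polyP /polyQ hornerD hornerXn !horner_sum.
by congr (_ + _ + _ * _); apply: eq_bigr => k _; rewrite hornerZ hornerXn.
Qed.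

(* Main.v *)
(* After the substitution s = s0 + z / tau, Delta becomes f = p + exp(- z) q
   with p monic of degree n and q of degree at most m, and each of the first
   three assertions says that the n + m + 1 first Taylor coefficients of f at 0
   are zero. Such a pair (p, q) is unique: n + 1 derivations kill p, and what
   remains of q has degree at most m and a zero of order m at 0. The explicit
   pair of (d) solves z f'' + (z - n - m) f' - n f = 0, because its coefficients
   satisfy two-term recurrences; the same equation, read on the Taylor
   coefficients of f, gives both their vanishing and the Kummer series.
   For the rightmost root, the equation makes
   t^(-n-m) exp(t x) Re((f' + f / 2) conj(f)) nondecreasing along the segment
   from 0 to a zero z of f with real part x > 0 when m <= n. *)
Require Import Defs.
From mathcomp Require Import all_boot all_order all_algebra.
From mathcomp Require Import all_classical all_reals all_analysis.
From mathcomp Require Import complex ring lra.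

Set Implicit Arguments.
Unset Strict Implicit.
Unset Printing Implicit Defensive.

Import Order.TTheory GRing.Theory Num.Theory.
Import numFieldNormedType.Exports.

Local Open Scope ring_scope.
Local Open Scope complex_scope.

(** The derivative of exp(- e z) q is exp(- e z) (q' - e q), so the functions p + exp(- z) q are
    stable under differentiation, and their derivatives at 0, the jets, are found by iterating
    operators on polynomials. Analysis enters through a single Taylor remainder estimate, which
    translates derivatives, Landau bounds and identities of functions into jets. For the explicit
    pair, the jets satisfy (k - n - m) J_(k+1) + (k - n) J_k = 0. The first factor vanishes only at
    k = n + m: the zero J_0 propagates up to J_(n+m), while J_(n+m+1) escapes the recurrence and is
    computed from q alone. Its value n! is nonzero, which makes the order of the zero exact, and it
    starts the Kummer coefficients. *)

(** * Curves in the complex plane, differentiated along a real parameter *)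

Section ComplexCurves.
Variable R : realType.
Local Notation C := R[i].
Local Notation Re := complex.Re.
Local Notation Im := complex.Im.

Lemma is_derive_le (f df : R -> R) (a b : R) : a <= b ->
  (forall t, a <= t <= b -> is_derive t (1 : R) f (df t)) ->
  (forall t, a <= t <= b -> 0 <= df t) -> f a <= f b.
Proof.
rewrite le_eqVlt => /predU1P[<- //|ab] fd df0.
have [||c cab] := @MVT R f df a b ab.
- by move=> x; rewrite in_itv /= => /andP[ax xb]; apply: fd; rewrite !ltW.
- apply: derivable_within_continuous => x; rewrite in_itv /= => xab.
  by have [] := fd x xab.
move=> eqf; rewrite -subr_ge0 eqf mulr_ge0//; last by rewrite subr_ge0 ltW.
by move: cab; rewrite in_itv /= => /andP[ac cb]; apply: df0; rewrite !ltW.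
Qed.

Lemma is_derive_funD (f g : R -> R) df dg t : is_derive t (1 : R) f df ->
  is_derive t (1 : R) g dg -> is_derive t (1 : R) (fun s => f s + g s) (df + dg).
Proof. by move=> fd gd; apply: is_deriveD. Qed.

Lemma is_derive_funM (f g : R -> R) df dg t : is_derive t (1 : R) f df ->
  is_derive t (1 : R) g dg ->
  is_derive t (1 : R) (fun s => f s * g s) (df * g t + f t * dg).
Proof.
move=> fd gd; have := is_deriveM fd gd.
change (f * g)%R with (fun s => f s * g s) => h; apply: is_derive_eq.
by rewrite /GRing.scale /= addrC [g t * _]mulrC.
Qed.

Lemma is_derive_funZ (k : R) (f : R -> R) df t : is_derive t (1 : R) f df ->
  is_derive t (1 : R) (fun s => k * f s) (k * df).
Proof. by move=> fd; apply: (is_deriveZ k fd). Qed.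

Lemma is_derive_expn k (t : R) :
  is_derive t (1 : R) (fun s => s ^+ k.+1) (k.+1%:R * t ^+ k).
Proof.
elim: k => [|k IH].
  by rewrite expr0 mulr1; apply: is_derive_id.
have h := is_derive_funM (is_derive_id t (1 : R)) IH.
have -> : (fun s => s ^+ k.+2) = (fun s : R => id s * s ^+ k.+1).
  by apply/funext => s; rewrite exprS.
apply: is_derive_eq.
by rewrite mul1r [in LHS]exprS -[k.+2]addn1 natrD exprS; ring.
Qed.

Lemma ReD (x y : C) : Re (x + y) = Re x + Re y. Proof. by case: x; case: y. Qed.
Lemma ImD (x y : C) : Im (x + y) = Im x + Im y. Proof. by case: x; case: y. Qed.
Lemma ReN (x : C) : Re (- x) = - Re x. Proof. by case: x. Qed.
Lemma ImN (x : C) : Im (- x) = - Im x. Proof. by case: x. Qed.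
Lemma ReM (x y : C) : Re (x * y) = Re x * Re y - Im x * Im y.
Proof. by case: x; case: y. Qed.
Lemma ImM (x y : C) : Im (x * y) = Re x * Im y + Im x * Re y.
Proof. by case: x; case: y. Qed.
Lemma complex_eq (x y : C) : Re x = Re y -> Im x = Im y -> x = y.
Proof. by case: x; case: y => ? ? ? ? /= -> ->. Qed.

(* An equivalent norm with values in R instead of R[i]. *)
Definition norm1 (z : C) : R := `|Re z| + `|Im z|.

Lemma norm1_ge0 z : 0 <= norm1 z. Proof. by rewrite addr_ge0. Qed.

Lemma norm1_0 : norm1 0 = 0. Proof. by rewrite /norm1 /= normr0 addr0. Qed.

Lemma norm1_eq0 z : norm1 z <= 0 -> z = 0.
Proof.
rewrite /norm1 => z0; apply: complex_eq => /=; apply/eqP;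
  rewrite -normr_le0; have := normr_ge0 (Re z); have := normr_ge0 (Im z); lra.
Qed.

Lemma norm1N z : norm1 (- z) = norm1 z.
Proof. by rewrite /norm1 ReN ImN !normrN. Qed.

Lemma norm1D x y : norm1 (x + y) <= norm1 x + norm1 y.
Proof.
rewrite /norm1 ReD ImD.
have := ler_normD (Re x) (Re y); have := ler_normD (Im x) (Im y); lra.
Qed.

Lemma norm1M x y : norm1 (x * y) <= norm1 x * norm1 y.
Proof.
rewrite /norm1 ReM ImM.
have := ler_normB (Re x * Re y) (Im x * Im y).
have := ler_normD (Re x * Im y) (Im x * Re y); rewrite !normrM; lra.
Qed.

Lemma norm1_real (x : R) : norm1 x%:C = `|x|.
Proof. by rewrite /norm1 /= normr0 addr0. Qed.

Lemma norm1_nat n : norm1 (n%:R : C) = n%:R.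
Proof.
have -> : n%:R = (n%:R : R)%:C :> C by rewrite rmorph_nat.
by rewrite norm1_real normr_nat.
Qed.

Lemma norm1_realM (x : R) z : norm1 (x%:C * z) = `|x| * norm1 z.
Proof. by rewrite /norm1 ReM ImM /= !mul0r subr0 addr0 !normrM mulrDr. Qed.

Lemma norm1X z k : norm1 (z ^+ k) <= norm1 z ^+ k.
Proof.
elim: k => [|k IH]; first by rewrite !expr0 -[1]/(1%:C) norm1_real normr1.
rewrite !exprS (le_trans (norm1M _ _))// ler_wpM2l// norm1_ge0//.
Qed.

Lemma norm1_sum n (F : 'I_n -> C) :
  norm1 (\sum_(i < n) F i) <= \sum_(i < n) norm1 (F i).
Proof.
elim/big_ind2: _ => //; first by rewrite norm1_0.
by move=> x1 x2 y1 y2 h1 h2; rewrite (le_trans (norm1D _ _))// lerD.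
Qed.

Lemma normc_le_norm1 (z : C) : `|z| <= (norm1 z)%:C.
Proof.
rewrite {1}[z]complexE (le_trans (ler_normD _ _))// normrM.
have normR (x : R) : `|x%:C| = `|x|%:C :> C.
  by rewrite normc_def /= expr0n addr0 sqrtr_sqr.
have -> : `|'i%C| = 1 :> C.
  by rewrite normc_def /= expr0n expr1n add0r sqrtr1.
by rewrite mul1r !normR -rmorphD.
Qed.

Lemma norm1_le_normc (z : C) : (norm1 z)%:C <= 2 * `|z|.
Proof.
rewrite /norm1 rmorphD mulr_natl mulr2n lerD ?normc_ge_Re//.
have := normc_ge_Re (z * 'i%C); rewrite ReiNIm normrN normrM.
have -> : `|'i%C| = 1 :> C.
  by rewrite normc_def /= expr0n expr1n add0r sqrtr1.
by rewrite mulr1.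
Qed.

(** Working with real and imaginary parts brings every estimate back to the real mean value
    theorem. *)
Definition is_cderive (g dg : R -> C) := forall t : R,
  is_derive t (1 : R) (fun t => Re (g t)) (Re (dg t)) /\
  is_derive t (1 : R) (fun t => Im (g t)) (Im (dg t)).

Lemma is_cderive_eq g dg dg' : is_cderive g dg -> dg =1 dg' -> is_cderive g dg'.
Proof. by move=> h e t; rewrite -e; apply: h. Qed.

Lemma is_cderive_ext g h dg : g =1 h -> is_cderive g dg -> is_cderive h dg.
Proof. by move=> /funext ->. Qed.

Lemma is_cderive_cst (c : C) : is_cderive (fun=> c) (fun=> 0).
Proof. by move=> t; split; exact: is_derive_cst. Qed.

Lemma is_cderive_id : is_cderive (fun t => t%:C) (fun=> 1).
Proof. by move=> t; split; [exact: is_derive_id|exact: is_derive_cst]. Qed.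

Lemma is_cderiveD g h dg dh : is_cderive g dg -> is_cderive h dh ->
  is_cderive (fun t => g t + h t) (fun t => dg t + dh t).
Proof.
move=> gd hd t; have [g1 g2] := gd t; have [h1 h2] := hd t.
rewrite (_ : (fun t => Re (g t + h t)) = (fun t => Re (g t) + Re (h t)));
  last by apply/funext => s; exact: ReD.
rewrite (_ : (fun t => Im (g t + h t)) = (fun t => Im (g t) + Im (h t)));
  last by apply/funext => s; exact: ImD.
by rewrite ReD ImD; split; apply: is_derive_funD.
Qed.

Lemma is_cderiveM g h dg dh : is_cderive g dg -> is_cderive h dh ->
  is_cderive (fun t => g t * h t) (fun t => dg t * h t + g t * dh t).
Proof.
move=> gd hd t; have [g1 g2] := gd t; have [h1 h2] := hd t.
have d1 := is_derive_funD (is_derive_funM g1 h1)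
  (is_derive_funZ (-1) (is_derive_funM g2 h2)).
have d2 := is_derive_funD (is_derive_funM g1 h2) (is_derive_funM g2 h1).
rewrite (_ : (fun t => Re (g t * h t)) = (fun t => Re (g t) * Re (h t)
  + -1 * (Im (g t) * Im (h t)))); last first.
  by apply/funext => s; rewrite ReM mulN1r.
rewrite (_ : (fun t => Im (g t * h t)) = (fun t => Re (g t) * Im (h t)
  + Im (g t) * Re (h t))); last by apply/funext => s; exact: ImM.
rewrite ReD ImD !ReM !ImM.
split; [apply: is_derive_eq d1 _|apply: is_derive_eq d2 _]; [ring|ring].
Qed.

Lemma is_cderive_cexp (w : C) :
  is_cderive (fun t => cexp (t%:C * w)) (fun t => w * cexp (t%:C * w)).
Proof.
move=> t.
have lin (k : R) : is_derive t (1 : R) (fun s : R => s * k) k.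
  have h := is_derive_funM (is_derive_id t (1 : R)) (is_derive_cst k t (1 : R)).
  by apply: is_derive_eq h _; rewrite mul1r mulr0 addr0.
pose a := Re w; pose b := Im w.
have dE : is_derive t (1 : R) (fun s => expR (s * a)) (expR (t * a) * a).
  exact: is_derive1_comp (is_derive_expR _) (lin a).
have dC : is_derive t (1 : R) (fun s => cos (s * b)) (- sin (t * b) * b).
  exact: is_derive1_comp (is_derive_cos _) (lin b).
have dS : is_derive t (1 : R) (fun s => sin (s * b)) (cos (t * b) * b).
  exact: is_derive1_comp (is_derive_sin _) (lin b).
have RE s : Re (s%:C * w) = s * a by rewrite ReM /= mul0r subr0.
have IE s : Im (s%:C * w) = s * b by rewrite ImM /= mul0r addr0.
have d1 := is_derive_funM dE dC; have d2 := is_derive_funM dE dS.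
rewrite (_ : (fun t => Re (cexp (t%:C * w))) =
   (fun s => expR (s * a) * cos (s * b))); last first.
  by apply/funext => s; rewrite /cexp RE IE ReM /= mul0r subr0.
rewrite (_ : (fun t => Im (cexp (t%:C * w))) =
   (fun s => expR (s * a) * sin (s * b))); last first.
  by apply/funext => s; rewrite /cexp RE IE ImM /= mul0r addr0.
rewrite ReM ImM /cexp RE IE !ReM !ImM /= !mul0r -/a -/b.
split; [apply: is_derive_eq d1 _|apply: is_derive_eq d2 _]; [ring|ring].
Qed.

Lemma is_cderive_horner (p : {poly C}) (w : C) :
  is_cderive (fun t => p.[t%:C * w]) (fun t => w * p^`().[t%:C * w]).
Proof.
elim/poly_ind: p => [|p c IH].
  apply: is_cderive_ext (is_cderive_eq (is_cderive_cst 0) _) => t.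
    by rewrite horner0.
  by rewrite deriv0 horner0 mulr0.
have lin : is_cderive (fun t => t%:C * w) (fun=> w).
  apply: is_cderive_eq (is_cderiveM is_cderive_id (is_cderive_cst w)) _ => t.
  by rewrite mul1r mulr0 addr0.
apply: is_cderive_ext (is_cderive_eq
  (is_cderiveD (is_cderiveM IH lin) (is_cderive_cst c)) _) => t.
  by rewrite hornerMXaddC.
by rewrite derivMXaddC hornerD hornerMX addr0; ring.
Qed.

(** For suitable signs, [norm1 (g t)] is e1 Re + e2 Im, and [h], the bound minus such a combination,
    is nondecreasing. Powers divided by factorials keep their shape under integration, so the lemma
    can be iterated. *)
Lemma norm1_curve_le (g dg : R -> C) (K : R) k : is_cderive g dg -> g 0 = 0 ->
  (forall t, 0 <= t <= 1 -> norm1 (dg t) <= K * (t ^+ k / k`!%:R)) ->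
  forall t, 0 <= t <= 1 -> norm1 (g t) <= K * (t ^+ k.+1 / k.+1`!%:R).
Proof.
move=> gd g0 dgK t /andP[t0 t1].
have sgn (e1 e2 : R) : `|e1| = 1 -> `|e2| = 1 ->
  e1 * Re (g t) + e2 * Im (g t) <= K * (t ^+ k.+1 / k.+1`!%:R).
  move=> e1E e2E.
  pose h s := K / k.+1`!%:R * s ^+ k.+1 + (- e1 * Re (g s) + - e2 * Im (g s)).
  have h0 : h 0 = 0 by rewrite /h g0 expr0n /= !mulr0 !addr0.
  suff : h 0 <= h t.
    have -> : K * (t ^+ k.+1 / k.+1`!%:R) = K / k.+1`!%:R * t ^+ k.+1 by ring.
    rewrite h0 /h; lra.
  apply: (@is_derive_le h (fun s => K / k.+1`!%:R * (k.+1%:R * s ^+ k)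
      + (- e1 * Re (dg s) + - e2 * Im (dg s)))) => // s /andP[s0 st].
    have [d1 d2] := gd s.
    exact: is_derive_funD (is_derive_funZ _ (is_derive_expn _ _))
      (is_derive_funD (is_derive_funZ _ d1) (is_derive_funZ _ d2)).
  have := dgK s; rewrite s0 (le_trans st)// => /(_ isT).
  have -> : K / k.+1`!%:R * (k.+1%:R * s ^+ k) = K * (s ^+ k / k`!%:R).
    rewrite factS natrM; field.
    by rewrite nat1r !pnatr_eq0 -lt0n fact_gt0.
  have : e1 * Re (dg s) <= `|Re (dg s)|.
    by rewrite (le_trans (ler_norm _))// normrM e1E mul1r.
  have : e2 * Im (dg s) <= `|Im (dg s)|.
    by rewrite (le_trans (ler_norm _))// normrM e2E mul1r.
  rewrite /norm1; lra.
have [e1 e1E e1g] : exists2 e : R, `|e| = 1 & e * Re (g t) = `|Re (g t)|.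
  by case: (ger0P (Re (g t))) => _; [exists 1|exists (-1)];
    rewrite ?normrN ?normr1 ?mul1r ?mulN1r.
have [e2 e2E e2g] : exists2 e : R, `|e| = 1 & e * Im (g t) = `|Im (g t)|.
  by case: (ger0P (Im (g t))) => _; [exists 1|exists (-1)];
    rewrite ?normrN ?normr1 ?mul1r ?mulN1r.
by rewrite /norm1 -e1g -e2g; apply: sgn.
Qed.

End ComplexCurves.

(** * Taylor remainder of exp(- e z) q(z) *)

Section ExponentialPolynomials.
Variable R : realType.
Local Notation C := R[i].
Local Notation Re := complex.Re.
Local Notation Im := complex.Im.
Implicit Types (e w z : C) (p q : {poly C}).

Lemma cexp0 : cexp (0 : C) = 1.
Proof. by rewrite /cexp /= expR0 cos0 sin0 mul1r. Qed.

Lemma cexpD w z : cexp (w + z) = cexp w * cexp z.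
Proof.
rewrite /cexp ReD ImD expRD cosD sinD.
by apply: complex_eq; rewrite !(ReM, ImM) /=; ring.
Qed.

Lemma cexp_real (x : R) : cexp x%:C = (expR x)%:C.
Proof. by rewrite /cexp /= cos0 sin0 mulr1. Qed.

Lemma norm1_cexp w : norm1 (cexp w) <= 2 * expR (norm1 w).
Proof.
rewrite /cexp norm1_realM ger0_norm ?expR_ge0// mulrC ler_pM ?norm1_ge0 ?expR_ge0//.
  rewrite /norm1 /=; have := cos_max (Im w); have := sin_max (Im w); lra.
by rewrite ler_expR (le_trans (ler_norm _))// lerDl.
Qed.

Definition expoly e q z : C := cexp (- (e * z)) * q.[z].

(* The polynomial factor of the derivative of expoly e q. *)
Definition expoly_deriv e q := q^`() - e *: q.

(** The exponential factor is 1 at 0, so the constant coefficient is the value there of the k-th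
    derivative. *)
Definition expoly_coef e q k := (iter k (expoly_deriv e) q)`_0 / k`!%:R.

Definition expoly_taylor e q L := \poly_(k < L) expoly_coef e q k.

(** The length [d] is fixed beforehand, so that all iterated derivatives are measured by the same
    norm. *)
Definition coefnorm d q : R := \sum_(i < d) norm1 q`_i.

Lemma size_expoly_deriv e d q :
  (size q <= d)%N -> (size (expoly_deriv e q) <= d)%N.
Proof.
move=> qd; rewrite (leq_trans (size_polyD _ _))// geq_max size_polyN.
rewrite (leq_trans (size_scale_leq _ _))// andbT.
by rewrite (leq_trans (leq_trans (size_poly _ _) (leq_pred _))).
Qed.

Lemma size_iter_expoly_deriv e d q k :
  (size q <= d)%N -> (size (iter k (expoly_deriv e) q) <= d)%N.
Proof. by move=> qd; elim: k => //= k; exact: size_expoly_deriv. Qed.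

Lemma coefnorm_ge0 d q : 0 <= coefnorm d q.
Proof. by apply: sumr_ge0 => i _; exact: norm1_ge0. Qed.

(** Derivation multiplies each coefficient by at most [d], and [e *: q] contributes [norm1 e]. The
    iterates thus grow only geometrically, which the factorial in the remainder absorbs. *)
Lemma coefnorm_expoly_deriv e d q : (size q <= d)%N ->
  coefnorm d (expoly_deriv e q) <= (d%:R + norm1 e) * coefnorm d q.
Proof.
move=> qd; rewrite mulrDl /coefnorm.
have -> : \sum_(i < d) norm1 (expoly_deriv e q)`_i =
  \sum_(i < d) norm1 (q`_i.+1 *+ i.+1 - e * q`_i).
  by apply: eq_bigr => i _; rewrite coefB coef_deriv coefZ.
have shift : \sum_(i < d) norm1 q`_i.+1 <= \sum_(i < d) norm1 q`_i.
  have : \sum_(i < d.+1) norm1 q`_i = \sum_(i < d) norm1 q`_i.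
    by rewrite big_ord_recr /= nth_default// norm1_0 addr0.
  move <-; rewrite big_ord_recl lerDr norm1_ge0//.
apply: (@le_trans _ _ (\sum_(i < d) (d%:R * norm1 q`_i.+1 + norm1 e * norm1 q`_i))).
  apply: ler_sum => i _; rewrite (le_trans (norm1D _ _))// norm1N lerD ?norm1M//.
  rewrite -[_ *+ i.+1]mulr_natl (le_trans (norm1M _ _))// norm1_nat ler_wpM2r ?norm1_ge0//.
  by rewrite ler_nat.
by rewrite big_split /= -!mulr_sumr lerD// ler_wpM2l.
Qed.

Lemma coefnorm_iter_expoly_deriv e d q k : (size q <= d)%N ->
  coefnorm d (iter k (expoly_deriv e) q) <= (d%:R + norm1 e) ^+ k * coefnorm d q.
Proof.
move=> qd; elim: k => [|k IH]; first by rewrite mul1r.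
rewrite iterS (le_trans (coefnorm_expoly_deriv _ (size_iter_expoly_deriv _ _ qd)))//.
by rewrite exprS -mulrA ler_wpM2l// addr_ge0 ?norm1_ge0.
Qed.

Lemma norm1_expoly e d q z (M : R) : (size q <= d)%N -> 1 <= M -> norm1 z <= M ->
  norm1 (expoly e q z) <= 2 * expR (norm1 e * M) * M ^+ d * coefnorm d q.
Proof.
move=> qd M1 zM; rewrite /expoly (le_trans (norm1M _ _))// -mulrA.
rewrite ler_pM ?norm1_ge0//.
  rewrite (le_trans (norm1_cexp _))// norm1N ler_wpM2l// ler_expR.
  by rewrite (le_trans (norm1M _ _))// ler_wpM2l ?norm1_ge0.
rewrite (horner_coef_wide _ qd) (le_trans (norm1_sum _))// mulr_sumr.
apply: ler_sum => i _; rewrite (le_trans (norm1M _ _))// mulrC.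
rewrite ler_wpM2r ?norm1_ge0// (le_trans (norm1X _ _))//.
rewrite (@le_trans _ _ (M ^+ i))//.
  by rewrite lerXn2r// nnegrE ?norm1_ge0// (le_trans ler01).
by rewrite ler_weXn2l// ltnW.
Qed.

Lemma is_cderive_expoly e q z :
  is_cderive (fun t => expoly e q (t%:C * z))
    (fun t => z * expoly e (expoly_deriv e q) (t%:C * z)).
Proof.
rewrite /expoly; apply: (@is_cderive_ext _
    (fun t => cexp (t%:C * - (e * z)) * q.[t%:C * z])) => [t|].
  by congr (cexp _ * _); ring.
apply: is_cderive_eq (is_cderiveM (is_cderive_cexp _) (is_cderive_horner _ _)) _.
move=> t; rewrite hornerD hornerN hornerZ.
have -> : - (e * (t%:C * z)) = t%:C * - (e * z) by ring.
by ring.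
Qed.

Lemma deriv_expoly_taylor e q L :
  (expoly_taylor e q L.+1)^`() = expoly_taylor e (expoly_deriv e q) L.
Proof.
apply/polyP => i; rewrite coef_deriv !coef_poly ltnS.
case: ifP => _; last by rewrite mul0rn.
rewrite /expoly_coef -iterSr factS natrM -[LHS]mulr_natl.
by field; rewrite nat1r !pnatr_eq0 -lt0n fact_gt0.
Qed.

(** Along [t], the derivative of the remainder of order L + 1 is [z] times the remainder of order L
    for [expoly_deriv e q]; hence an induction with [q] general, each step being one integration. *)
Lemma expoly_taylor_le e q L z (K : R) :
  (forall t : R, 0 <= t <= 1 ->
    norm1 (expoly e (iter L (expoly_deriv e) q) (t%:C * z)) <= K) ->
  forall t : R, 0 <= t <= 1 ->
    norm1 (expoly e q (t%:C * z) - (expoly_taylor e q L).[t%:C * z])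
    <= K * norm1 z ^+ L * (t ^+ L / L`!%:R).
Proof.
elim: L q => [|L IH] q qK t t01.
  rewrite /expoly_taylor poly_def big_ord0 horner0 subr0 !expr0 divr1 !mulr1.
  exact: qK.
pose g s := expoly e q (s%:C * z) - (expoly_taylor e q L.+1).[s%:C * z].
apply: (@norm1_curve_le _ g (fun s => z * (expoly e (expoly_deriv e q) (s%:C * z)
  - (expoly_taylor e (expoly_deriv e q) L).[s%:C * z]))) t01.
- rewrite -deriv_expoly_taylor; apply: is_cderive_ext (is_cderive_eq
    (is_cderiveD (is_cderive_expoly e q z) (is_cderiveM (is_cderive_cst (- 1))
      (is_cderive_horner (expoly_taylor e q L.+1) z))) _) => s.
    by rewrite mulN1r.
  by ring.
- rewrite /g mul0r /expoly mulr0 oppr0 cexp0 mul1r !horner_coef0 coef_poly /=.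
  by rewrite /expoly_coef /= divr1 subrr.
- move=> s s01; rewrite (le_trans (norm1M _ _))//.
  have -> : K * norm1 z ^+ L.+1 * (s ^+ L / L`!%:R) =
      norm1 z * (K * norm1 z ^+ L * (s ^+ L / L`!%:R)) by rewrite exprS; ring.
  by rewrite ler_wpM2l ?norm1_ge0// IH// -iterSr.
Qed.

(** The constants do not depend on [L]: a fixed [L] gives estimates near 0, and [L] tending to
    infinity gives the convergence of the Taylor series. *)
Lemma expoly_taylor_bound e q (M : R) : exists2 c : R, 0 <= c &
  exists2 b : R, 0 <= b & forall L z, norm1 z <= M ->
    norm1 (expoly e q z - (expoly_taylor e q L).[z])
    <= c * ((b * norm1 z) ^+ L / L`!%:R).
Proof.
(* A radius at least 1 lets [M' ^+ d] bound all lower powers of z. *)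
pose M' := Num.max 1 M; pose d := size q.
have M'1 : 1 <= M' by rewrite le_max lexx.
have c0 : 0 <= 2 * expR (norm1 e * M') * M' ^+ d.
  by rewrite !mulr_ge0 ?expR_ge0// exprn_ge0// (le_trans ler01).
exists (2 * expR (norm1 e * M') * M' ^+ d * coefnorm d q).
  by rewrite mulr_ge0// coefnorm_ge0.
exists (d%:R + norm1 e); first by rewrite addr_ge0 ?norm1_ge0.
move=> L z zM.
have := @expoly_taylor_le e q L z (2 * expR (norm1 e * M') * M' ^+ d *
   ((d%:R + norm1 e) ^+ L * coefnorm d q)) _ 1.
rewrite !mul1r ler01 lexx expr1n => /(_ _ isT)/le_trans -> //.
  move=> t /andP[t0 t1].
  have tz : norm1 (t%:C * z) <= M'.
    rewrite norm1_realM ger0_norm// (@le_trans _ _ (norm1 z))//.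
      by rewrite ler_piMl// norm1_ge0.
    by rewrite le_max zM orbT.
  rewrite (le_trans (norm1_expoly e (size_iter_expoly_deriv e L (leqnn d)) M'1 tz))//.
  by rewrite ler_wpM2l// coefnorm_iter_expoly_deriv.
by rewrite exprMn div1r le_eqVlt; apply/orP; left; apply/eqP; ring.
Qed.

End ExponentialPolynomials.

(** * Functions p + exp(- z) q and their jets at 0 *)

Section ExponentialPairs.
Variable R : realType.
Local Notation C := R[i].
Implicit Types (w z : C) (p q : {poly C}).

Definition fpair p q z : C := p.[z] + cexp (- z) * q.[z].

(* The k-th derivative of fpair p q at 0. *)
Definition pair_jet p q k : C :=
  (iter k (expoly_deriv 0) p)`_0 + (iter k (expoly_deriv 1) q)`_0.

Lemma fpair_expoly p q z : fpair p q z = expoly 0 p z + expoly 1 q z.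
Proof. by rewrite /fpair /expoly mul0r oppr0 cexp0 !mul1r. Qed.

Lemma expoly_derivZ e c q : expoly_deriv e (c *: q) = c *: expoly_deriv e q.
Proof. by rewrite /expoly_deriv derivZ scalerBr !scalerA [e * c]mulrC. Qed.

Lemma expoly_derivB e p q :
  expoly_deriv e (p - q) = expoly_deriv e p - expoly_deriv e q.
Proof. by rewrite /expoly_deriv derivB scalerBr !opprD addrACA. Qed.

Lemma expoly_deriv_shift e q w :
  expoly_deriv e (q \Po ('X + w%:P)) = expoly_deriv e q \Po ('X + w%:P).
Proof.
rewrite /expoly_deriv deriv_comp derivD derivX derivC addr0 mulr1.
by rewrite raddfB /= comp_polyZ.
Qed.

Lemma fpairB p q p' q' z :
  fpair (p - p') (q - q') z = fpair p q z - fpair p' q' z.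
Proof. by rewrite /fpair !hornerD !hornerN; ring. Qed.

Lemma pair_jetB p q p' q' k :
  pair_jet (p - p') (q - q') k = pair_jet p q k - pair_jet p' q' k.
Proof.
have itB e (r r' : {poly C}) : iter k (expoly_deriv e) (r - r') =
  iter k (expoly_deriv e) r - iter k (expoly_deriv e) r'.
  by elim: k => //= k ->; rewrite expoly_derivB.
by rewrite /pair_jet !itB !coefB addrACA opprD.
Qed.

Lemma pair_jetS p q k :
  pair_jet p q k.+1 = pair_jet (expoly_deriv 0 p) (expoly_deriv 1 q) k.
Proof. by rewrite /pair_jet !iterSr. Qed.

Lemma fpair0 p q : fpair p q 0 = pair_jet p q 0.
Proof. by rewrite /fpair oppr0 cexp0 mul1r !horner_coef0. Qed.

Lemma fpair_shift p q w z : fpair p q (w + z) =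
  fpair (p \Po ('X + w%:P)) (cexp (- w) *: (q \Po ('X + w%:P))) z.
Proof.
rewrite /fpair hornerZ !horner_comp hornerD hornerX hornerC opprD cexpD.
by rewrite [z + w]addrC; ring.
Qed.

Lemma fpair_taylor p q (M : R) : exists2 c : R, 0 <= c &
  exists2 b : R, 0 <= b & forall L z, norm1 z <= M ->
    norm1 (fpair p q z - \sum_(k < L) pair_jet p q k / k`!%:R * z ^+ k)
    <= c * ((b * norm1 z) ^+ L / L`!%:R).
Proof.
have [c1 c1_ge0 [b1 b1_ge0 h1]] := expoly_taylor_bound 0 p M.
have [c2 c2_ge0 [b2 b2_ge0 h2]] := expoly_taylor_bound 1 q M.
exists (c1 + c2); first exact: addr_ge0.
exists (b1 + b2); first exact: addr_ge0.
move=> L z zM.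
have -> : fpair p q z - \sum_(k < L) pair_jet p q k / k`!%:R * z ^+ k =
  (expoly 0 p z - (expoly_taylor 0 p L).[z])
  + (expoly 1 q z - (expoly_taylor 1 q L).[z]).
  rewrite fpair_expoly addrACA -opprD; congr (_ - _).
  rewrite !horner_poly -big_split /=; apply: eq_bigr => k _.
  by rewrite -mulrDl /expoly_coef -mulrDl.
rewrite (le_trans (norm1D _ _))// mulrDl lerD//.
  rewrite (le_trans (h1 L z zM))// ler_wpM2l// ler_wpM2r ?invr_ge0//.
  by rewrite lerXn2r ?nnegrE ?mulr_ge0 ?addr_ge0 ?norm1_ge0// ler_wpM2r ?norm1_ge0// lerDl.
rewrite (le_trans (h2 L z zM))// ler_wpM2l// ler_wpM2r ?invr_ge0//.
by rewrite lerXn2r ?nnegrE ?mulr_ge0 ?addr_ge0 ?norm1_ge0// ler_wpM2r ?norm1_ge0// lerDr.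
Qed.

(** This is [fpair_taylor] with [L = 2], translated to [w]: a quadratic error amounts to complex
    differentiability with an explicit derivative. *)
Lemma fpair_affine p q w (M : R) : exists2 c : R, 0 <= c &
  forall z, norm1 z <= M ->
    norm1 (fpair p q (w + z) - fpair p q w
      - z * fpair (expoly_deriv 0 p) (expoly_deriv 1 q) w)
    <= c * norm1 z ^+ 2.
Proof.
have [c c0 [b b0 h]] := fpair_taylor (p \Po ('X + w%:P))
  (cexp (- w) *: (q \Po ('X + w%:P))) M.
exists (c * (b ^+ 2 / 2)); first by rewrite !mulr_ge0 ?invr_ge0 ?exprn_ge0.
move=> z zM; have := h 2%N z zM.
rewrite -fpair_shift 2!big_ord_recr big_ord0 /= pair_jetS -!fpair0.
rewrite expoly_derivZ !expoly_deriv_shift -!fpair_shift addr0.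
rewrite expr0 expr1 add0r !divr1 mulr1 exprMn.
have -> : 2`!%:R = 2 :> R by [].
by rewrite opprD addrA [z * _]mulrC mulrAC -!mulrA.
Qed.

(** Once the lower jets vanish, the term a z^k is the difference of f and a Taylor remainder, both
    O(z^(k+1)). On small positive reals t this reads [norm1 a <= K * t], which forces a = 0. *)
Lemma jet_eq0 p q N (c d : R) : 0 < d ->
  (forall z, norm1 z <= d -> norm1 (fpair p q z) <= c * norm1 z ^+ N) ->
  forall k, (k < N)%N -> pair_jet p q k = 0.
Proof.
move=> d0 hO k; elim/ltn_ind: k => k IH kN.
have [c' c'0 [b b0 h]] := fpair_taylor p q d.
pose a := pair_jet p q k / k`!%:R.
suff a0 : a = 0.
  move/eqP: a0; rewrite mulf_eq0 invr_eq0 pnatr_eq0.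
  by rewrite eqn0Ngt fact_gt0 orbF => /eqP.
pose K := `|c| + c' * (b ^+ k.+1 / k.+1`!%:R).
have K0 : 0 <= K by rewrite addr_ge0// !mulr_ge0 ?invr_ge0 ?exprn_ge0.
have aK (t : R) : 0 < t -> t <= d -> t <= 1 -> norm1 a <= K * t.
  move=> t0 td t1.
  have nt : norm1 t%:C = t by rewrite norm1_real gtr0_norm.
  have ntd : norm1 t%:C <= d by rewrite nt.
  have := h k.+1 _ ntd; rewrite big_ord_recr /= big1 => [|i _]; last first.
    by rewrite IH ?mul0r// (ltn_trans _ kN).
  rewrite add0r -/a nt => h1; have := hO _ ntd; rewrite nt => h2.
  have : norm1 (a * t%:C ^+ k) <= K * t ^+ k.+1.
    have -> : a * t%:C ^+ k = fpair p q t%:C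
      + - (fpair p q t%:C - a * t%:C ^+ k) by ring.
    rewrite (le_trans (norm1D _ _))// norm1N mulrDl lerD//.
      rewrite (le_trans h2)// (@le_trans _ _ (`|c| * t ^+ N))//.
        by rewrite ler_wpM2r ?ler_norm// exprn_ge0// ltW.
      by rewrite ler_wpM2l// ler_wiXn2l// ltW.
    rewrite (le_trans h1)// exprMn le_eqVlt; apply/orP; left; apply/eqP; ring.
  rewrite -rmorphXn mulrC norm1_realM ger0_norm; last by rewrite exprn_ge0// ltW.
  by rewrite [t ^+ k.+1]exprS mulrA [_ * norm1 a]mulrC ler_pM2r// exprn_gt0.
apply: norm1_eq0; rewrite leNgt; apply/negP => na.
(* Small enough for [K * t < norm1 a]. *)
pose t := Num.min (Num.min d 1) (norm1 a / (2 * (K + 1))).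
have t0 : 0 < t by rewrite !lt_min d0 ltr01 divr_gt0// mulr_gt0// ltr_wpDl.
have td : t <= d by rewrite !ge_min lexx.
have t1 : t <= 1 by rewrite !ge_min lexx orbT.
have tK : t <= norm1 a / (2 * (K + 1)) by rewrite ge_min lexx orbT.
have := aK t t0 td t1.
rewrite ler_pdivlMr in tK; last by rewrite mulr_gt0// ltr_wpDl.
nra.
Qed.

End ExponentialPairs.

(** * Complex derivatives and Landau bounds in terms of [norm1] *)

Section ComplexDerivative.
Variable R : realType.
Local Notation C := R[i].
Implicit Types (w z : C) (p q : {poly C}).
Local Open Scope classical_set_scope.

Lemma gt0_complexE (x : C) : 0 < x -> x = (complex.Re x)%:C /\ 0 < complex.Re x.
Proof.
by case: x => a b; rewrite ltcE /= => /andP[/eqP -> a0].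
Qed.

Lemma ltc_real (x y : R) : (x%:C < y%:C) = (x < y).
Proof. by rewrite ltcE /= eqxx. Qed.

Lemma lec_real (x y : R) : (x%:C <= y%:C) = (x <= y).
Proof. by rewrite lecE /= eqxx. Qed.

Lemma norm1_lec (z : C) (x : R) : `|z| <= x%:C -> norm1 z <= 2 * x.
Proof.
move=> zx; rewrite -lec_real (le_trans (norm1_le_normc z))// rmorphM /=.
by rewrite rmorph_nat ler_pM2l.
Qed.

Lemma lec_norm1 (z : C) (x : R) : norm1 z <= x -> `|z| <= x%:C.
Proof. by move=> zx; rewrite (le_trans (normc_le_norm1 z))// lec_real. Qed.

Lemma derive1_quadratic (f : C -> C) (a l : C) (c : R) : 0 <= c ->
  (forall h, norm1 h <= 1 -> norm1 (f (a + h) - f a - l * h) <= c * norm1 h ^+ 2) ->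
  derive1 f a = l.
Proof.
move=> c0 fq; rewrite /derive1; apply: cvg_lim => //.
apply/cvgrPdist_le => eps /gt0_complexE[-> e0].
set e := complex.Re eps in e0 *.
(* A modulus at most d gives [norm1 h <= 2 * d], whence the bound 2^-1; the error of the difference
   quotient is then at most c * 2d * 2, whence the 4. *)
pose d := Num.min (2^-1) (e / (4 * (c + 1))).
have d0 : 0 < d.
  by rewrite lt_min invr_gt0 ltr0n divr_gt0// mulr_gt0// ltr_wpDl.
have dC : 0 < d%:C by rewrite ltc_real.
near=> h.
have h0 : h != 0 by near: h; exact: nbhs_dnbhs_neq.
have hd : `|h| <= d%:C by near: h; exact: dnbhs0_le.
have h1 : norm1 h <= 2 * d by exact: norm1_lec.
have hd2 : 2 * d <= 1 by rewrite mulrC -ler_pdivlMr// mul1r ge_min lexx.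
have := fq h (le_trans h1 hd2) => fh.
have nh : (norm1 h)%:C <= 2 * `|h| := norm1_le_normc h.
rewrite distrC.
have -> : h^-1 *: (f (h + a) - f a) - l = h^-1 * (f (a + h) - f a - l * h).
  by rewrite /GRing.scale /= [h + a]addrC; field.
rewrite normrM normrV ?unitfE// mulrC ler_pdivrMr ?normr_gt0//.
apply: (le_trans (normc_le_norm1 _)).
apply: (@le_trans _ _ ((c * 2 * d)%:C * (norm1 h)%:C)).
  rewrite -rmorphM lec_real (le_trans fh)// expr2 mulrA.
  rewrite ler_wpM2r ?norm1_ge0// -mulrA ler_wpM2l//.
apply: (@le_trans _ _ ((c * 2 * d)%:C * (2 * `|h|))).
  by rewrite ler_wpM2l// lec_real !mulr_ge0// ltW.
rewrite mulrA ler_pM2r ?normr_gt0//.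
have -> : (c * 2 * d)%:C * 2 = (c * 2 * d * 2)%:C by rewrite [RHS]rmorphM rmorph_nat.
rewrite lec_real.
have : d <= e / (4 * (c + 1)) by rewrite ge_min lexx orbT.
rewrite ler_pdivlMr; last by rewrite mulr_gt0// ltr_wpDl.
by move=> dd; nra.
Unshelve. all: by end_near.
Qed.

(** The family of functions s |-> k f(x0 (s - a)) contains [Delta] and is closed under derivation,
    which makes all iterated derivatives explicit. *)
Lemma derive1_fpair_affine p q (k x0 a s : C) :
  derive1 (fun s => k * fpair p q (x0 * (s - a))) s =
  k * x0 * fpair (expoly_deriv 0 p) (expoly_deriv 1 q) (x0 * (s - a)).
Proof.
have [c c0 h] := fpair_affine p q (x0 * (s - a)) (norm1 x0).
apply: (@derive1_quadratic _ _ _ (norm1 k * (c * norm1 x0 ^+ 2))).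
  by rewrite !mulr_ge0 ?exprn_ge0 ?norm1_ge0.
move=> u u1.
set D := fpair (expoly_deriv 0 p) _ _ in h *.
have -> : k * fpair p q (x0 * (s + u - a)) - k * fpair p q (x0 * (s - a))
  - k * x0 * D * u = k * (fpair p q (x0 * (s - a) + x0 * u)
     - fpair p q (x0 * (s - a)) - x0 * u * D).
  have -> : x0 * (s + u - a) = x0 * (s - a) + x0 * u by ring.
  by ring.
have xu : norm1 (x0 * u) <= norm1 x0 * norm1 u := norm1M _ _.
rewrite (le_trans (norm1M _ _))// -[leRHS]mulrA ler_wpM2l ?norm1_ge0//.
rewrite (le_trans (h _ _))//.
  by rewrite (le_trans xu)// ler_piMr// norm1_ge0.
by rewrite -mulrA -exprMn ler_wpM2l// lerXn2r ?nnegrE ?mulr_ge0 ?norm1_ge0.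
Qed.

Lemma derive1n_fpair_affine p q (k x0 a : C) j :
  derive1n j (fun s => k * fpair p q (x0 * (s - a))) =
  (fun s => k * x0 ^+ j *
     fpair (iter j (expoly_deriv 0) p) (iter j (expoly_deriv 1) q) (x0 * (s - a))).
Proof.
elim: j => [|j IH]; first by apply/funext => s; rewrite expr0 mulr1.
rewrite derive1nS IH; apply/funext => s.
by rewrite derive1_fpair_affine exprSr mulrA.
Qed.

Lemma bigO_le_norm1 (f : C -> C) N (c : R) :
  (forall z, norm1 z <= 1 -> norm1 (f z) <= c * norm1 z ^+ N) ->
  f =O_ (0 : C) (fun z : C => z ^+ N).
Proof.
move=> fN; apply/eqO_exP; exists ((`|c| + 1) * 2 ^+ N)%:C.
  by rewrite ltc_real mulr_gt0 ?exprn_gt0// ltr_wpDl.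
have e0 : 0 < (2^-1)%:C :> C by rewrite ltc_real invr_gt0.
near=> z.
have zd : `|z| <= (2^-1)%:C by near: z; exact: nbhs0_le.
have z1 : norm1 z <= 1 by have := norm1_lec zd; rewrite divff.
apply: (le_trans (lec_norm1 (fN z z1))).
apply: (@le_trans _ _ ((`|c| + 1)%:C * (norm1 z)%:C ^+ N)).
  rewrite -rmorphXn -rmorphM lec_real ler_wpM2r ?exprn_ge0 ?norm1_ge0//.
  by rewrite (le_trans (ler_norm c))// lerDl.
rewrite rmorphM rmorphXn normrX -mulrA -exprMn ler_wpM2l//.
  by rewrite lec_real addr_ge0.
rewrite rmorph_nat.
rewrite lerXn2r ?nnegrE ?mulr_ge0// ?norm1_le_normc//.
by rewrite lec_real norm1_ge0.
Unshelve. all: by end_near.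
Qed.

Lemma bigO_norm1_le (f : C -> C) N :
  f =O_ (0 : C) (fun z : C => z ^+ N) ->
  exists c d : R, 0 < d /\
    forall z, norm1 z <= d -> norm1 (f z) <= c * norm1 z ^+ N.
Proof.
move=> /eqO_exP[k /gt0_complexE[-> k0]] /nbhs_ballP[d /gt0_complexE[-> d0]] fk.
exists (2 * complex.Re k), (complex.Re d / 2); split; first exact: divr_gt0.
move=> z zd; rewrite -mulrA; apply: norm1_lec; rewrite rmorphM.
apply: le_trans (fk z _) _ => /=.
  rewrite -ball_normE /= sub0r normrN (le_lt_trans (lec_norm1 zd))//.
  by rewrite ltc_real ltr_pdivrMr// ltr_pMr// ltr1n.
rewrite normrX ler_wpM2l//; first by rewrite lec_real ltW.
rewrite rmorphXn lerXn2r ?nnegrE//.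
  by rewrite lec_real norm1_ge0.
exact: normc_le_norm1.
Qed.

End ComplexDerivative.

(** * The differential equation on polynomial factors, and uniqueness *)

Section PadeAlgebra.
Variable R : realType.
Local Notation C := R[i].
Implicit Types (e a b : C) (p q u : {poly C}).

Lemma expoly_derivD e p q :
  expoly_deriv e (p + q) = expoly_deriv e p + expoly_deriv e q.
Proof. by rewrite /expoly_deriv derivD scalerDr opprD addrACA. Qed.

Lemma expoly_deriv0 e : expoly_deriv e 0 = 0.
Proof. by rewrite /expoly_deriv deriv0 scaler0 subrr. Qed.

Lemma iter_expoly_deriv_0 e k : iter k (expoly_deriv e) 0 = 0.
Proof. by elim: k => //= k ->; exact: expoly_deriv0. Qed.

Lemma expoly_derivMX e u : expoly_deriv e ('X * u) = u + 'X * expoly_deriv e u.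
Proof.
by rewrite /expoly_deriv derivM derivX mul1r mulrBr -scalerAr addrA.
Qed.

Lemma iter_expoly_deriv0 k p : iter k (expoly_deriv 0) p = p^`(k).
Proof.
by elim: k => //= k ->; rewrite /expoly_deriv scale0r subr0.
Qed.

Lemma coef_expoly_deriv e u i :
  (expoly_deriv e u)`_i = i.+1%:R * u`_i.+1 - e * u`_i.
Proof. by rewrite coefB coef_deriv coefZ mulr_natl. Qed.

(* The operator z f'' + z f' + a f' + b f, read on the polynomial factor of
   exp (- e z) u. *)
Definition kummer_op e a b u : {poly C} :=
  'X * expoly_deriv e (expoly_deriv e u) + 'X * expoly_deriv e u
  + a *: expoly_deriv e u + b *: u.

(** Differentiating z f'' yields an extra f'', and z f' an extra f': thus f' satisfies the same
    equation with both parameters raised by 1. *)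
Lemma expoly_deriv_kummer_op e a b u :
  expoly_deriv e (kummer_op e a b u) = kummer_op e (a + 1) (b + 1) (expoly_deriv e u).
Proof.
rewrite /kummer_op; move E1: (expoly_deriv e u) => s1.
move E2: (expoly_deriv e s1) => s2.
rewrite !expoly_derivD !expoly_derivMX !expoly_derivZ E1 E2 !scalerDl !scale1r.
by rewrite -!mul_polyC; ring.
Qed.

(** This is the k-th derivative of the equation, taken at 0 where the terms with a factor z drop
    out. *)
Lemma kummer_op_jet e a b u k : kummer_op e a b u = 0 ->
  (a + k%:R) * (iter k.+1 (expoly_deriv e) u)`_0
  + (b + k%:R) * (iter k (expoly_deriv e) u)`_0 = 0.
Proof.
move=> u0.
have : kummer_op e (a + k%:R) (b + k%:R) (iter k (expoly_deriv e) u) = 0.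
  elim: k => [|k IH]; first by rewrite !addr0.
  by rewrite -natr1 !addrA iterS -expoly_deriv_kummer_op IH expoly_deriv0.
rewrite /kummer_op /=; move: (iter k _ u) => v; move E1: (expoly_deriv e v) => v1.
move: (expoly_deriv e v1) => v2 /(congr1 (fun v : {poly C} => v`_0)).
by rewrite coef0 !coefD !coefZ !coefXM !add0r.
Qed.

Lemma pair_jet_rec p q a b k : kummer_op 0 a b p = 0 -> kummer_op 1 a b q = 0 ->
  (a + k%:R) * pair_jet p q k.+1 + (b + k%:R) * pair_jet p q k = 0.
Proof.
move=> /(@kummer_op_jet _ _ _ _ k) hp /(@kummer_op_jet _ _ _ _ k) hq.
by rewrite /pair_jet !mulrDr addrACA hp hq addr0.
Qed.

(** The exponential factor, being 1 at 0, does not affect the lowest term of the expansion. *)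
Lemma expoly_jet_lead e u k : (forall i, (i < k)%N -> u`_i = 0) ->
  (iter k (expoly_deriv e) u)`_0 = k`!%:R * u`_k.
Proof.
elim: k u => [|k IH] u u0; first by rewrite mul1r.
rewrite iterSr IH => [|i ik].
  by rewrite coef_expoly_deriv [u`_k]u0// mulr0 subr0 mulrA -natrM mulnC -factS.
by rewrite coef_expoly_deriv !u0 ?mulr0 ?subr0// ltnW.
Qed.

Lemma expoly_jet_eq0 e u k :
  (forall j, (j < k)%N -> (iter j (expoly_deriv e) u)`_0 = 0) ->
  forall i, (i < k)%N -> u`_i = 0.
Proof.
move=> jet0; elim/ltn_ind => i IH ik.
have /eqP := jet0 i ik; rewrite expoly_jet_lead => [|j ji]; last first.
  by rewrite IH// (ltn_trans ji).
by rewrite mulf_eq0 pnatr_eq0 eqn0Ngt fact_gt0 /= => /eqP.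
Qed.

(** Differentiation lowers the degree, so u' = u has no nonzero polynomial solution. *)
Lemma expoly_deriv1_inj u : expoly_deriv 1 u = 0 -> u = 0.
Proof.
move=> /eqP; rewrite /expoly_deriv scale1r subr_eq0 => /eqP du.
apply/eqP; apply: contraT => u0.
by have := lt_size_deriv u0; rewrite du ltnn.
Qed.

Lemma iter_expoly_deriv1_inj k u : iter k (expoly_deriv 1) u = 0 -> u = 0.
Proof. by elim: k => //= k IH /expoly_deriv1_inj. Qed.

Lemma poly_eq0_coef u k : (size u <= k)%N ->
  (forall i, (i < k)%N -> u`_i = 0) -> u = 0.
Proof.
move=> uk u0; apply/polyP => i; rewrite coef0.
by case: (ltnP i k) => [/u0//|ki]; rewrite nth_default// (leq_trans uk).
Qed.

(** Meant for the difference of two pairs with monic first entries, whence the size [n]. Then n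
    derivations already kill [p], and the jets n to n + m annihilate the m + 1 coefficients of what
    remains of [q]. *)
Lemma pair_jet_uniq p q n m : (size p <= n)%N -> (size q <= m.+1)%N ->
  (forall k, (k < n + m + 1)%N -> pair_jet p q k = 0) -> p = 0 /\ q = 0.
Proof.
move=> pn qm jet0.
have q0 : q = 0.
  apply: (@iter_expoly_deriv1_inj n); apply: (@poly_eq0_coef _ m.+1).
    exact: size_iter_expoly_deriv.
  apply: (@expoly_jet_eq0 1) => j jm.
  have := jet0 (j + n)%N; rewrite /pair_jet !iterD.
  rewrite [iter n _ p]iter_expoly_deriv0 derivn_poly0// iter_expoly_deriv_0.
  rewrite coef0 add0r; apply.
  by rewrite addn1 ltnS addnC leq_add2l.
split=> //; apply: (poly_eq0_coef pn); apply: (@expoly_jet_eq0 0) => j jn.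
have := jet0 j; rewrite /pair_jet q0 iter_expoly_deriv_0.
by rewrite coef0 addr0; apply; rewrite -addnA ltn_addr.
Qed.

(** * The explicit pair and its jets *)

Section Solution.
Variables n m : nat.

(** Here and in [padeQ], the coefficients are those of (d) at s0 = 0 and tau = 1, where only the
    term j = k survives. *)
Definition padeP : {poly C} := \poly_(k < n.+1)
  ((-1) ^+ (n - k) * n`!%:R * ('C(m + n - k, m)%:R / k`!%:R)).

Definition padeQ : {poly C} := \poly_(k < m.+1)
  (- (-1) ^+ n * ((m + n - k)`!%:R / (k`!%:R * (m - k)`!%:R))).

Lemma factC_neq0 k : k`!%:R != 0 :> C.
Proof. by rewrite pnatr_eq0 -lt0n fact_gt0. Qed.

Lemma padeP_op : kummer_op 0 (- (n + m)%:R) (- n%:R) padeP = 0.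
Proof.
apply/polyP => k.
have -> : (kummer_op 0 (- (n + m)%:R) (- n%:R) padeP)`_k =
  k%:R * k.+1%:R * padeP`_k.+1 + k%:R * padeP`_k
  - (n + m)%:R * k.+1%:R * padeP`_k.+1 - n%:R * padeP`_k.
  rewrite /kummer_op !coefD !coefZ !coefXM !coef_expoly_deriv !mul0r !subr0.
  by case: k => [|k] /=; rewrite ?mul0r ?coef_expoly_deriv ?mul0r ?subr0; ring.
rewrite coef0 !coef_poly !ltnS; case: (ltngtP k n) => [kn|nk|->]; last 2 first.
- by rewrite !mulr0 !subr0 addr0.
- by rewrite !mulr0 subr0 add0r subrr.
have e1 : (n - k = (n - k.+1).+1)%N by rewrite subnSK.
have e2 : (m + n - k = (m + n - k.+1).+1)%N.
  by rewrite subnSK// ltn_addl.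
have e3 : (n + m)%:R = (m + n - k.+1).+1%:R + k%:R :> C.
  by rewrite -natrD -e2 subnK ?(addnC n)// ltnW// ltn_addl.
have e4 : n%:R = (n - k.+1).+1%:R + k%:R :> C by rewrite -natrD -e1 subnK// ltnW.
(* The absorption identity for binomials is exactly the two-term recurrence on the coefficients. *)
have bin : (m + n - k.+1).+1%:R * 'C(m + n - k.+1, m)%:R =
   (n - k.+1).+1%:R * 'C((m + n - k.+1).+1, m)%:R :> C.
  rewrite -!natrM; congr (_%:R).
  have := mul_bin_down (m + n - k.+1).+1 m; rewrite /= -e2 => ->.
  by congr muln; rewrite -e1 subnAC addKn.
rewrite ?kn ?(ltnW kn) e1 e2 e3 e4 factS natrM exprS.
set N1 := (m + n - k.+1).+1%:R in bin *.
set D1 := (n - k.+1).+1%:R in bin *.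
set B := 'C((m + n - k.+1).+1, m)%:R in bin *.
set B' := 'C(m + n - k.+1, m)%:R in bin *.
set s := (-1) ^+ _; set nf := n`!%:R.
have kf := factC_neq0 k; have k0 : k.+1%:R != 0 :> C by rewrite pnatr_eq0.
transitivity (s * nf / k`!%:R * (D1 * B - N1 * B')); last by rewrite bin subrr mulr0.
by field; rewrite kf nat1r k0.
Qed.

(** For e = 1 the equation reads z q'' - z q' - (n + m) q' + m q = 0, which is that of [padeP] with
    z replaced by - z and n, m exchanged. *)
Lemma padeQ_op : kummer_op 1 (- (n + m)%:R) (- n%:R) padeQ = 0.
Proof.
apply/polyP => k.
have -> : (kummer_op 1 (- (n + m)%:R) (- n%:R) padeQ)`_k =
  k%:R * k.+1%:R * padeQ`_k.+1 - k%:R * padeQ`_k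
  - (n + m)%:R * k.+1%:R * padeQ`_k.+1 + m%:R * padeQ`_k.
  rewrite /kummer_op !coefD !coefZ !coefXM !coef_expoly_deriv natrD !mul1r.
  by case: k => [|k] /=; rewrite ?mul0r ?coef_expoly_deriv ?mul1r; ring.
rewrite coef0 !coef_poly !ltnS; case: (ltngtP k m) => [km|mk|->]; last 2 first.
- by rewrite !mulr0 !subr0 addr0.
- rewrite !mulr0 subr0 add0r; ring.
have e1 : (m - k = (m - k.+1).+1)%N by rewrite subnSK.
have e2 : (m + n - k = (m + n - k.+1).+1)%N by rewrite subnSK// ltn_addr.
have e3 : (n + m)%:R = (m + n - k.+1).+1%:R + k%:R :> C.
  by rewrite -natrD -e2 subnK ?(addnC n)// ltnW// ltn_addr.
have e4 : m%:R = (m - k.+1).+1%:R + k%:R :> C by rewrite -natrD -e1 subnK// ltnW.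
rewrite ?km ?(ltnW km) e3 e4 e1 e2 !factS !natrM.
set N1 := (m + n - k.+1).+1%:R; set D1 := (m - k.+1).+1%:R.
set s := (-1) ^+ _.
by field; rewrite !nat1r !factC_neq0 !pnatr_eq0.
Qed.

Lemma size_padeP : size padeP = n.+1.
Proof.
rewrite size_poly_eq// subnn addnK binn mul1r mul1r divff ?factC_neq0//.
Qed.

Lemma padeP_coefn : padeP`_n = 1.
Proof. by rewrite coef_poly ltnSn subnn addnK binn !mul1r divff ?factC_neq0. Qed.

Lemma size_padeQ : (size padeQ <= m.+1)%N. Proof. exact: size_poly. Qed.

Lemma pade_jet_rec k : (k%:R - (n + m)%:R) * pair_jet padeP padeQ k.+1
  + (k%:R - n%:R) * pair_jet padeP padeQ k = 0.
Proof.
have := pair_jet_rec k padeP_op padeQ_op.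
by rewrite ![- _ + k%:R]addrC.
Qed.

Lemma pade_jet0 : pair_jet padeP padeQ 0 = 0.
Proof.
rewrite /pair_jet /= !coef_poly /= !subn0 fact0 mul1r divr1.
rewrite -(@bin_fact (m + n) m) ?leq_addr// addKn !natrM.
by field; rewrite !factC_neq0.
Qed.

Lemma pade_jet_eq0 k : (k < n + m + 1)%N -> pair_jet padeP padeQ k = 0.
Proof.
elim: k => [|k IH] kN; first exact: pade_jet0.
have := pade_jet_rec k; rewrite (IH (ltnW kN)) mulr0 addr0 => /eqP.
rewrite mulf_eq0 subr_eq0 eqr_nat => /orP[/eqP kE|/eqP//].
by move: kN; rewrite kE addn1 ltnn.
Qed.

(* The (n+1)-st derivative kills p and turns q into (-1)^(n+1) q_m z^m. *)
Lemma pade_jet_lead : pair_jet padeP padeQ (n + m + 1) = n`!%:R.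
Proof.
have jetE j : pair_jet padeP padeQ (j + n.+1) =
    (iter j (expoly_deriv 1) (iter n.+1 (expoly_deriv 1) padeQ))`_0.
  rewrite /pair_jet !iterD [iter n.+1 _ padeP]iter_expoly_deriv0.
  by rewrite derivn_poly0 ?size_padeP// iter_expoly_deriv_0 coef0 add0r.
have leadE k : (iter k (expoly_deriv 1) padeQ)`_m = (-1) ^+ k * padeQ`_m.
  elim: k => [|k IH]; first by rewrite mul1r.
  rewrite iterS coef_expoly_deriv IH [X in _ * X - _]nth_default.
    by rewrite mulr0 sub0r exprS mul1r mulN1r mulNr.
  exact: size_iter_expoly_deriv size_padeQ.
have -> : (n + m + 1 = m + n.+1)%N by rewrite addn1 addnS addnC.
rewrite jetE expoly_jet_lead; last first.
  apply: (@expoly_jet_eq0 1) => j jm; rewrite -jetE; apply: pade_jet_eq0.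
  by rewrite addnS addn1 ltnS addnC -addnS leq_add2l.
rewrite leadE coef_poly ltnSn subnn addKn exprS fact0.
have := sqrr_sign C n; set s := (-1) ^+ n => s2.
transitivity (s ^+ 2 * n`!%:R : C); last by rewrite s2 mul1r.
by field; rewrite factC_neq0.
Qed.

(** At k = n + m + 1 + j the factors of the recurrence are j + 1 and m + 1 + j, the sources of j!
    and of the ascending factorial. *)
Lemma pade_jet_kummer j : pair_jet padeP padeQ (n + m + 1 + j) =
  n`!%:R * ((-1) ^+ j * ascfact (m + 1)%:R j / j`!%:R).
Proof.
elim: j => [|j IH]; first by rewrite addn0 pade_jet_lead expr0 divr1 !mulr1.
have := pade_jet_rec (n + m + 1 + j).
rewrite IH -addnS.
have -> : (n + m + 1 + j)%:R - (n + m)%:R = j.+1%:R :> C.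
  by rewrite -addnA natrD addrAC subrr add0r add1n.
have -> : (n + m + 1 + j)%:R - n%:R = (m + 1)%:R + j%:R :> C.
  by rewrite -!addnA natrD addrAC subrr add0r addnA natrD.
move=> /eqP; rewrite addr_eq0 => /eqP h.
have j0 : j.+1%:R != 0 :> C by rewrite pnatr_eq0.
apply: (mulfI j0); rewrite h factS natrM exprS /=.
by field; rewrite nat1r factC_neq0 pnatr_eq0.
Qed.

End Solution.
End PadeAlgebra.

(** * Identification with the Kummer series *)

Section KummerSeries.
Variable R : realType.
Local Notation C := R[i].
Local Open Scope classical_set_scope.

(** The majorant is a multiple of the general term of the exponential series, which tends to 0. *)
Lemma cvg_norm1_exp (u : nat -> C) (l : C) (c x : R) : 0 <= c -> 0 <= x ->
  (forall j, norm1 (u j - l) <= c * (x ^+ j / j`!%:R)) -> limn u = l.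
Proof.
move=> c0 x0 ul; apply: cvg_lim => //.
apply/cvgrPdist_le => eps /gt0_complexE[-> e0].
have := cvg_series_cvg_0 (is_cvg_series_exp_coeff x).
move/cvgrPdist_le => /(_ (complex.Re eps / (c + 1)))[|k _ hk].
  by rewrite divr_gt0// ltr_wpDl.
exists k => // j kj /=; rewrite distrC; apply: lec_norm1.
rewrite (le_trans (ul j))//; have := hk j kj; rewrite /= sub0r normrN.
rewrite /exp_coeff /=; have : 0 <= x ^+ j / j`!%:R by rewrite divr_ge0// exprn_ge0.
move: (x ^+ j / _) => y y0; rewrite ger0_norm// ler_pdivlMr; last by rewrite ltr_wpDl.
nra.
Qed.

Lemma fact_ascfact (n : nat) k :
  (n + k)`!%:R = n`!%:R * ascfact (n + 1)%:R k :> C.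
Proof.
elim: k => [|k IH]; first by rewrite addn0 mulr1.
by rewrite addnS factS natrM IH /= -natrD addn1 addSn; ring.
Qed.

Lemma ascfact_nat_neq0 (n : nat) k : ascfact (n + 1)%:R k != 0 :> C.
Proof.
apply/negP => /eqP a0; have := fact_ascfact n k; rewrite a0 mulr0 => /eqP.
by apply/negP; exact: factC_neq0.
Qed.

(** The Taylor sum of length N + j is [K] times the j-th partial sum of the Kummer series, and the
    remainder tends to 0 with j. The point z = 0 is apart because the limit is taken after dividing
    by [K]. *)
Lemma fpair_pade_kummer (n m : nat) (z : C) :
  fpair (padeP R n m) (padeQ R n m) z = n`!%:R * z ^+ (n + m + 1)
    / ((n + m + 1)`!)%:R * kummer (m + 1)%:R (n + m + 2)%:R (- z).
Proof.
set N := (n + m + 1)%N.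
have [->|z0] := eqVneq z 0.
  by rewrite fpair0 pade_jet0 /N addn1 expr0n mulr0 !mul0r.
pose K : C := n`!%:R * z ^+ N / N`!%:R.
have K0 : K != 0 by rewrite !mulf_neq0 ?invr_eq0 ?factC_neq0 ?expf_neq0.
have [c c0 [b b0 h]] := fpair_taylor (padeP R n m) (padeQ R n m) (norm1 z).
suff -> : kummer (m + 1)%:R (n + m + 2)%:R (- z) =
    fpair (padeP R n m) (padeQ R n m) z / K by rewrite mulrC divfK.
have x0 : 0 <= b * norm1 z by rewrite mulr_ge0 ?norm1_ge0.
apply: (@cvg_norm1_exp _ _
  (norm1 K^-1 * (c * (b * norm1 z) ^+ N)) (b * norm1 z)) => //.
  by rewrite !mulr_ge0 ?exprn_ge0 ?norm1_ge0.
move=> j; set s := series _ j.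
have sE : \sum_(k < N + j) pair_jet (padeP R n m) (padeQ R n m) k / k`!%:R * z ^+ k
    = K * s.
  rewrite big_split_ord /= big1 ?add0r => [|i _]; last first.
    by rewrite pade_jet_eq0 ?mul0r.
  rewrite /s /series /= big_mkord mulr_sumr; apply: eq_bigr => i _.
  (* The factorial (N + i)! = N! (N + 1)_i produces the second parameter n + m + 2. *)
  rewrite pade_jet_kummer fact_ascfact.
  have -> : (N + 1 = n + m + 2)%N by rewrite /N -addnA.
  rewrite exprD [(- z) ^+ i]exprNn /K.
  field.
  have := ascfact_nat_neq0 N i; rewrite /N -[(_ + 1 + 1)%N]addnA => ->.
  by rewrite !factC_neq0.
have := h (N + j)%N z (lexx _); rewrite sE => hN.
have -> : s - fpair (padeP R n m) (padeQ R n m) z / K =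
    - K^-1 * (fpair (padeP R n m) (padeQ R n m) z - K * s) by field.
rewrite (le_trans (norm1M _ _))// norm1N -[leRHS]mulrA ler_wpM2l ?norm1_ge0//.
rewrite (le_trans hN)// -mulrA ler_wpM2l// exprD -!mulrA ler_wpM2l ?exprn_ge0//.
rewrite ler_wpM2l ?exprn_ge0// lef_pV2 ?posrE ?ltr0n ?fact_gt0//.
by rewrite ler_nat leq_fact // leq_addl.
Qed.

End KummerSeries.

(** * Rescaling the quasipolynomial *)

Section Quasipolynomial.
Variables (R : realType) (n m : nat) (tau s0 : R).
Hypothesis tau_gt0 : 0 < tau.
Variables (a : 'I_n -> R) (alpha : 'I_m.+1 -> R).
Local Notation C := R[i].
Local Notation P := (Ptilde tau s0 a).
Local Notation Q := (Qtilde n tau s0 alpha).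

Lemma tauC_neq0 : tau%:C != 0 :> C.
Proof. by rewrite gt_eqF// ltc_real. Qed.

Lemma Deltatilde_fpair z : Deltatilde tau s0 a alpha z = fpair P Q z.
Proof.
rewrite /Deltatilde Delta_polyPQ /fpair horner_Ptilde horner_Qtilde.
have -> : - (s0%:C + z / tau%:C) * tau%:C = (- s0 * tau)%:C + - z.
  by rewrite rmorphM rmorphN; field; exact: tauC_neq0.
by rewrite cexpD cexp_real; ring.
Qed.

Lemma Delta_fpair :
  Delta tau a alpha = fun s => tau%:C ^- n * fpair P Q (tau%:C * (s - s0%:C)).
Proof.
apply/funext => s; rewrite -Deltatilde_fpair /Deltatilde mulKf ?expf_neq0 ?tauC_neq0//.
by congr Delta; field; exact: tauC_neq0.
Qed.

Lemma derive1n_Delta k : derive1n k (Delta tau a alpha) s0%:C =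
  tau%:C ^- n * tau%:C ^+ k * pair_jet P Q k.
Proof.
rewrite Delta_fpair derive1n_fpair_affine subrr mulr0 fpair0.
by rewrite /pair_jet.
Qed.

Lemma coef_polyP (k : 'I_n) : (Defs.polyP a)`_k = (a k)%:C.
Proof.
rewrite /Defs.polyP coefD coefXn ltn_eqF// add0r coef_sum (bigD1 k)//= big1 => [|i ik].
  by rewrite coefZ coefXn eqxx mulr1 addr0.
by rewrite coefZ coefXn eq_sym; move: ik; rewrite -val_eqE /= => /negPf ->; rewrite mulr0.
Qed.

Lemma polyP_monic : (Defs.polyP a)`_n = 1 /\ (size (Defs.polyP a) <= n.+1)%N.
Proof.
split.
  rewrite /Defs.polyP coefD coefXn eqxx coef_sum big1 ?addr0// => i _.
  by rewrite coefZ coefXn gtn_eqF// mulr0.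
rewrite (leq_trans (size_polyD _ _))// size_polyXn geq_max leqnn /=.
rewrite (leq_trans (size_sum _ _ _))//; apply/bigmax_leqP => i _.
by rewrite (leq_trans (size_scale_leq _ _))// size_polyXn ltnS ltnW.
Qed.

Lemma coef_polyQ (k : 'I_m.+1) : (polyQ alpha)`_k = (alpha k)%:C.
Proof.
rewrite /polyQ coef_sum (bigD1 k)//= big1 => [|i ik].
  by rewrite coefZ coefXn eqxx mulr1 addr0.
by rewrite coefZ coefXn eq_sym; move: ik; rewrite -val_eqE /= => /negPf ->; rewrite mulr0.
Qed.

Lemma size_polyQ : (size (polyQ alpha) <= m.+1)%N.
Proof.
rewrite (leq_trans (size_sum _ _ _))//; apply/bigmax_leqP => i _.
by rewrite (leq_trans (size_scale_leq _ _))// size_polyXn.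
Qed.

Let L : {poly C} := s0%:C%:P + (tau%:C)^-1 *: 'X.
Let L' : {poly C} := tau%:C *: ('X - s0%:C%:P).

Lemma comp_rescaleK (p : {poly C}) : (p \Po L) \Po L' = p.
Proof.
rewrite -comp_polyA (_ : L \Po L' = 'X) ?comp_polyXr//.
rewrite /L comp_polyD comp_polyC comp_polyZ comp_polyX /L' scalerA.
by rewrite mulVf ?tauC_neq0// scale1r addrC subrK.
Qed.

Lemma comp_rescaleKV (p : {poly C}) : (p \Po L') \Po L = p.
Proof.
rewrite -comp_polyA (_ : L' \Po L = 'X) ?comp_polyXr//.
rewrite /L' comp_polyZ comp_polyB comp_polyC comp_polyX /L addrC addKr scalerA.
by rewrite mulfV ?tauC_neq0// scale1r.
Qed.

Lemma size_scale_comp_rescale (c : C) (p : {poly C}) : (size (c *: (p \Po L)) <= size p)%N.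
Proof.
rewrite (leq_trans (size_scale_leq _ _))//.
have [->|p0] := eqVneq p 0; first by rewrite comp_poly0 size_poly0.
have LE : (size L <= 2)%N.
  rewrite (leq_trans (size_polyD _ _))// geq_max (leq_trans (size_polyC_leq1 _))//.
  by rewrite (leq_trans (size_scale_leq _ _))// size_polyX.
have := size_comp_poly_leq p L; move/leq_trans; apply.
rewrite -[leqRHS]prednK ?size_poly_gt0// ltnS.
by rewrite -[leqRHS]muln1 leq_mul// -subn1 leq_subLR.
Qed.

Lemma coef_comp_unscale (p : {poly C}) d k : (size p <= d)%N ->
  (p \Po L')`_k = \sum_(k <= j < d)
    p`_j * tau%:C ^+ j * (- s0%:C) ^+ (j - k) * 'C(j, k)%:R.
Proof.
move=> pd.
have -> : (p \Po L')`_k =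
    \sum_(0 <= j < d) p`_j * tau%:C ^+ j * (- s0%:C) ^+ (j - k) * 'C(j, k)%:R.
  rewrite big_mkord.
  have {1}-> : p = \poly_(j < d) p`_j.
    apply/polyP => j; rewrite coef_poly; case: ltnP => // dj.
    by rewrite nth_default// (leq_trans pd).
  rewrite poly_def raddf_sum coef_sum; apply: eq_bigr => j _ /=.
  rewrite comp_polyZ comp_Xn_poly /L' exprZn scalerA coefZ -mulrA; congr (_ * _).
  rewrite addrC -polyCN exprDn coef_sum.
  have coefE (i : 'I_j.+1) :
      ((- s0%:C)%:P ^+ (j - i) * 'X ^+ i *+ 'C(j, i))`_k =
      if i == k :> nat then (- s0%:C) ^+ (j - k) * 'C(j, k)%:R else 0.
    rewrite coefMn -polyC_exp coefCM coefXn eq_sym.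
    by case: eqP => [->|_]; rewrite ?mulr1 ?mulr0 ?mul0rn// mulr_natr.
  rewrite (eq_bigr _ (fun i _ => coefE i)).
  case: (ltnP k j.+1) => [kj|jk].
    rewrite (bigD1 (Ordinal kj))//= eqxx big1 ?addr0// => i.
    by rewrite -val_eqE /= => /negPf ->.
  rewrite bin_small// mulr0 big1// => i _.
  by rewrite ltn_eqF// (leq_trans (ltn_ord i)).
(* Terms with j < k have a zero binomial, so the sum may start at k; for k > d both sides vanish. *)
have [kd|dk] := leqP k d; last first.
  rewrite [RHS]big_geq; last exact: ltnW.
  rewrite big_nat big1// => j jd.
  by rewrite bin_small ?mulr0// (ltn_trans _ dk).
rewrite (@big_cat_nat _ _ _ k)//= big_nat big1 ?add0r// => j jk.
by rewrite bin_small ?mulr0.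
Qed.

End Quasipolynomial.

(** * The coefficient formulas of (d) *)

Section Coefficients.
Variables (R : realType) (n m : nat) (tau s0 : R).
Hypothesis tau_gt0 : 0 < tau.
Variables (a : 'I_n -> R) (alpha : 'I_m.+1 -> R).
Local Notation C := R[i].
Local Notation P := (Ptilde tau s0 a).
Local Notation Q := (Qtilde n tau s0 alpha).
Let L' : {poly C} := tau%:C *: ('X - s0%:C%:P).

Lemma Ptilde_eq_comp (p : {poly C}) :
  P = p <-> Defs.polyP a = tau%:C ^- n *: (p \Po L').
Proof.
have tn0 : tau%:C ^+ n != 0 :> C by rewrite expf_neq0// tauC_neq0.
split=> [<-|h].
  by rewrite comp_polyZ scalerA mulVf// scale1r comp_rescaleK.
by rewrite /Ptilde h comp_polyZ comp_rescaleKV// scalerA mulfV// scale1r.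
Qed.

Lemma Qtilde_eq_comp (q : {poly C}) : Q = q <->
  polyQ alpha = ((expR (s0 * tau))%:C * tau%:C ^- n) *: (q \Po L').
Proof.
have tn0 : tau%:C ^+ n != 0 :> C by rewrite expf_neq0// tauC_neq0.
have EE : (expR (s0 * tau))%:C * (expR (- s0 * tau))%:C = 1 :> C.
  by rewrite -rmorphM -expRD -mulrDl subrr mul0r expR0.
have EK : (expR (s0 * tau))%:C * tau%:C ^- n *
    ((expR (- s0 * tau))%:C * tau%:C ^+ n) = 1 :> C.
  by rewrite mulrACA EE mulVf// mulr1.
split=> [<-|h].
  by rewrite comp_polyZ scalerA EK scale1r comp_rescaleK.
by rewrite /Qtilde h comp_polyZ comp_rescaleKV// scalerA mulrC EK scale1r.
Qed.

(** The formula arises from the binomial expansion of (s - s0)^j; the sign (-1)^(n-j) of [padeP] and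
    that of (- s0)^(j-k) merge into (-1)^(n-k). *)
Lemma coef_padeP_comp k : (tau%:C ^- n *: (padeP R n m \Po L'))`_k =
  ((-1) ^+ (n - k) * n`!%:R * \sum_(k <= j < n.+1)
     'C(j, k)%:R * 'C(m + n - j, m)%:R * s0 ^+ (j - k)
       / (j`!%:R * tau ^+ (n - j)))%:C.
Proof.
rewrite coefZ (coef_comp_unscale _ _ _ (eq_leq (size_padeP R n m))).
rewrite rmorphM rmorph_sum !mulr_sumr; apply: eq_big_nat => j /andP[kj jn].
rewrite coef_poly jn.
rewrite !(rmorphM, rmorphXn, rmorphN, rmorph1, rmorph_nat, fmorphV) /=.
rewrite ltnS in jn.
have -> : (n - k = (n - j) + (j - k))%N by rewrite addnBA// subnK.
have t0 := tauC_neq0 tau_gt0.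
have -> : tau%:C ^+ n = tau%:C ^+ (n - j) * tau%:C ^+ j :> C.
  by rewrite -exprD subnK.
rewrite [(- _) ^+ (j - k)]exprNn exprD.
by field; rewrite !expf_neq0// factC_neq0.
Qed.

(** The exponents n - 1 and n - j are integers: n may be 0, and j exceeds n when m is large. *)
Lemma coef_padeQ_comp k :
  (((expR (s0 * tau))%:C * tau%:C ^- n) *: (padeQ R n m \Po L'))`_k =
  ((-1) ^ (n%:Z - 1) * expR (s0 * tau) * \sum_(k <= j < m.+1)
     (-1) ^+ (j - k) * ((m + n - j)`!)%:R * s0 ^+ (j - k)
       / (k`!%:R * ((j - k)`!)%:R * ((m - j)`!)%:R * tau ^ (n%:Z - j%:Z)))%:C.
Proof.
rewrite coefZ (coef_comp_unscale _ _ _ (size_padeQ R n m)).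
rewrite rmorphM rmorph_sum !mulr_sumr; apply: eq_big_nat => j /andP[kj jm].
rewrite coef_poly jm.
have t0 := tauC_neq0 tau_gt0.
have -> : (-1) ^ (n%:Z - 1) = - (-1) ^+ n :> R.
  by rewrite expfzDr ?oppr_eq0 ?oner_eq0// exprN1 invrN invr1 mulrN1.
have -> : tau ^ (n%:Z - j%:Z) = tau ^+ n / tau ^+ j.
  by rewrite expfzDr ?gt_eqF// exprnN.
rewrite !(rmorphM, rmorphXn, rmorphN, rmorph1, rmorph_nat, fmorphV) /=.
rewrite [(- _) ^+ (j - k)]exprNn -(bin_fact kj) !natrM.
have b0 : 'C(j, k)%:R != 0 :> C by rewrite pnatr_eq0 -lt0n bin_gt0.
by field; rewrite b0 !factC_neq0 !expf_neq0.
Qed.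

Lemma padeP_coefs : P = padeP R n m <-> forall k : 'I_n,
  a k = (-1) ^+ (n - k) * n`!%:R * \sum_(k <= j < n.+1)
     'C(j, k)%:R * 'C(m + n - j, m)%:R * s0 ^+ (j - k)
       / (j`!%:R * tau ^+ (n - j)).
Proof.
rewrite Ptilde_eq_comp; split=> [h k|h].
  by apply: complexI; rewrite -coef_padeP_comp -h coef_polyP.
have [an sa] := polyP_monic a.
apply/polyP => k; rewrite coef_padeP_comp.
case: (ltngtP k n) => [kn|nk|->].
- by rewrite -[k]/(nat_of_ord (Ordinal kn)) coef_polyP h.
- by rewrite nth_default ?(leq_trans sa)// big_geq// mulr0.
(* At k = n the formula gives 1, in agreement with the implicit leading coefficient. *)
rewrite an big_nat1 !subnn binn addnK binn !expr0 !mulr1 !mul1r.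
by rewrite divff// pnatr_eq0 -lt0n fact_gt0.
Qed.

Lemma padeQ_coefs : Q = padeQ R n m <-> forall k : 'I_m.+1,
  alpha k = (-1) ^ (n%:Z - 1) * expR (s0 * tau) * \sum_(k <= j < m.+1)
     (-1) ^+ (j - k) * ((m + n - j)`!)%:R * s0 ^+ (j - k)
       / (k`!%:R * ((j - k)`!)%:R * ((m - j)`!)%:R * tau ^ (n%:Z - j%:Z)).
Proof.
rewrite Qtilde_eq_comp; split=> [h k|h].
  by apply: complexI; rewrite -coef_padeQ_comp -h coef_polyQ.
apply/polyP => k; rewrite coef_padeQ_comp.
case: (ltnP k m.+1) => km.
  by rewrite -[k]/(nat_of_ord (Ordinal km)) coef_polyQ h.
by rewrite nth_default ?(leq_trans (size_polyQ alpha))// big_geq// mulr0.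
Qed.

(** This is the hub of the equivalences: uniqueness is applied to the difference with the explicit
    pair. *)
Lemma pade_jets : (forall k, (k < n + m + 1)%N -> pair_jet P Q k = 0) <->
  P = padeP R n m /\ Q = padeQ R n m.
Proof.
split=> [jet0|[-> ->]]; last exact: pade_jet_eq0.
have sP : (size P <= n.+1)%N.
  by rewrite (leq_trans (size_scale_comp_rescale _ _ _ _)) ?(polyP_monic a).2.
have sQ : (size Q <= m.+1)%N.
  by rewrite (leq_trans (size_scale_comp_rescale _ _ _ _)) ?size_polyQ.
suff [/subr0_eq p0 /subr0_eq q0] : P - padeP R n m = 0 /\ Q - padeQ R n m = 0.
  by [].
apply: (@pair_jet_uniq _ _ _ n m).
- have sD : (size (P - padeP R n m)%R <= n.+1)%N.
    by rewrite (leq_trans (size_polyD _ _))// geq_max sP size_polyN size_padeP leqnn.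
  have Pn : (P : seq C)`_n = 1.
    have := (Ptilde_eq_comp P).1 erefl => /(congr1 (fun p : {poly C} => p`_n)).
    rewrite (polyP_monic a).1 coefZ (coef_comp_unscale _ _ _ sP) big_nat1 subnn binn.
    by rewrite expr0 !mulr1 [_ * tau%:C ^+ n]mulrC mulKf// expf_neq0// tauC_neq0.
  (* Both first entries are monic of degree n, so size n + 1 would mean a zero leading
     coefficient. *)
  move: sD; rewrite leq_eqVlt => /orP[/eqP sE|//].
  have : lead_coef (P - padeP R n m) = 0.
    by rewrite lead_coefE sE coefB padeP_coefn Pn subrr.
  by move/eqP; rewrite lead_coef_eq0 -size_poly_eq0 sE.
- rewrite (leq_trans (size_polyD _ _))// geq_max sQ size_polyN.
  exact: size_padeQ.
- move=> k kN; rewrite pair_jetB jet0// sub0r pade_jet_eq0 ?oppr0//.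
Qed.

End Coefficients.

(** * Location of the other roots *)

Section Rightmost.
Variable R : realType.
Local Notation C := R[i].
Local Notation Re := complex.Re.
Local Notation Im := complex.Im.
Implicit Types (p q : {poly C}) (z : C).

Lemma norm1_fpair_jets p q N (M : R) :
  (forall k, (k < N)%N -> pair_jet p q k = 0) ->
  exists2 c : R, 0 <= c & forall z, norm1 z <= M ->
    norm1 (fpair p q z) <= c * norm1 z ^+ N.
Proof.
move=> jet0; have [c c0 [b b0 h]] := fpair_taylor p q M.
exists (c * (b ^+ N / N`!%:R)); first by rewrite !mulr_ge0 ?invr_ge0 ?exprn_ge0.
move=> z zM; have := h N z zM; rewrite big1 => [|i _]; last by rewrite jet0// !mul0r.
by rewrite subr0 exprMn -!mulrA [_ / N`!%:R]mulrC.
Qed.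

Lemma is_cderive_fpair p q z : is_cderive (fun t => fpair p q (t%:C * z))
  (fun t => z * fpair (expoly_deriv 0 p) (expoly_deriv 1 q) (t%:C * z)).
Proof.
apply: is_cderive_ext (is_cderive_eq
  (is_cderiveD (is_cderive_expoly 0 p z) (is_cderive_expoly 1 q z)) _) => t.
  by rewrite fpair_expoly.
by rewrite fpair_expoly mulrDr.
Qed.

Lemma fpair_kummer_op (a b : C) p q z :
  kummer_op 0 a b p = 0 -> kummer_op 1 a b q = 0 ->
  let p1 := expoly_deriv 0 p in let q1 := expoly_deriv 1 q in
  z * fpair (expoly_deriv 0 p1) (expoly_deriv 1 q1) z + z * fpair p1 q1 z
  + a * fpair p1 q1 z + b * fpair p q z = 0.
Proof.
rewrite /kummer_op /=.
move E1: (expoly_deriv 0 p) => p1; move: (expoly_deriv 0 p1) => p2.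
move E2: (expoly_deriv 1 q) => q1; move: (expoly_deriv 1 q1) => q2.
move=> /(congr1 (horner^~ z)) /= hp /(congr1 (horner^~ z)) /= hq.
rewrite !hornerD !hornerM !hornerZ hornerX horner0 in hp hq.
rewrite /fpair; transitivity
  (z * p2.[z] + z * p1.[z] + a * p1.[z] + b * p.[z] + cexp (- z) *
  (z * q2.[z] + z * q1.[z] + a * q1.[z] + b * q.[z])); first by ring.
by rewrite hp hq mulr0 addr0.
Qed.

Lemma is_derive_pow k (t : R) : t != 0 ->
  is_derive t (1 : R) (fun s => s ^+ k) (k%:R * t ^+ k / t).
Proof.
case: k => [|k] t0.
  by rewrite !mul0r; exact: is_derive_cst.
by apply: is_derive_eq (is_derive_expn k t) _; rewrite exprSr; field.
Qed.

Lemma eq0_linear_bound (x c d : R) : 0 < d ->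
  (forall e, 0 < e -> e <= d -> x <= c * e) -> x <= 0.
Proof.
move=> d0 h; rewrite leNgt; apply/negP => x0.
pose e := Num.min d (x / (2 * (`|c| + 1))).
have cc : 0 < 2 * (`|c| + 1) by rewrite mulr_gt0// ltr_wpDl.
have e0 : 0 < e by rewrite lt_min d0 divr_gt0.
have := h e e0; rewrite ge_min lexx => /(_ isT).
have : e <= x / (2 * (`|c| + 1)) by rewrite ge_min lexx orbT.
rewrite ler_pdivlMr// => ex.
have := ler_norm c; nra.
Qed.

(** With w = f' + c f, the cross terms are - c t Re(z f conj(w)) and - (1 - c) t Re(z w conj(f)).
    For c = 1/2 they add up to - t x Re(w conj(f)): the imaginary part y cancels, and an integrating
    factor absorbs the rest. The coefficient n - (n + m)/2 of |f|^2 is where m <= n comes from. *)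
Lemma kummer_flow_identity (t x y n m u1 u2 v1 v2 r1 r2 : R) :
  t * r1 = (n + m) * v1 - t * (x * v1 - y * v2) + n * u1 ->
  t * r2 = (n + m) * v2 - t * (x * v2 + y * v1) + n * u2 ->
  let w1 := v1 + 2^-1 * u1 in let w2 := v2 + 2^-1 * u2 in
  t * ((x * v1 - y * v2) * w1 + u1 * (r1 + 2^-1 * (x * v1 - y * v2))
     + ((x * v2 + y * v1) * w2 + u2 * (r2 + 2^-1 * (x * v2 + y * v1))))
  + t * x * (u1 * w1 + u2 * w2) - (n + m) * (u1 * w1 + u2 * w2)
  = ((n - m) / 2 + t * x / 4) * (u1 ^+ 2 + u2 ^+ 2)
    + t * x * (w1 ^+ 2 + w2 ^+ 2).
Proof.
move=> o1 o2 w1 w2; apply: subr0_eq; transitivity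
  (u1 * (t * r1 - ((n + m) * v1 - t * (x * v1 - y * v2) + n * u1))
   + u2 * (t * r2 - ((n + m) * v2 - t * (x * v2 + y * v1) + n * u2))).
  by rewrite /w1 /w2; field.
by rewrite o1 o2 !subrr !mulr0 addr0.
Qed.

(* With M = n + m and w = f' + f / 2, the equation
   z f'' + (z - M) f' - n f = 0 gives
   t^(M+1) exp(- t x) F'(t) = ((n - m)/2 + t x / 4) |f|^2 + t x |w|^2
   for F(t) = t^(-M) exp(t x) Re(w conj(f)) on the ray t |-> t z, x = Re z.
   As F is zero at both ends of the segment, it vanishes identically, so f has
   zeros on the ray arbitrarily close to 0, against its order being finite. *)
Lemma pade_root_Re (n m : nat) z : (m <= n)%N ->
  fpair (padeP R n m) (padeQ R n m) z = 0 -> Re z <= 0.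
Proof.
move=> mn fz0; rewrite leNgt; apply/negP => x0.
set p := padeP R n m in fz0; set q := padeQ R n m in fz0.
set x := Re z in x0; pose y := Im z.
pose p1 := expoly_deriv 0 p; pose q1 := expoly_deriv 1 q.
pose u t := fpair p q (t%:C * z); pose v t := fpair p1 q1 (t%:C * z).
pose v' t := fpair (expoly_deriv 0 p1) (expoly_deriv 1 q1) (t%:C * z).
pose w t := v t + (2^-1)%:C * u t.
have ud : is_cderive u (fun t => z * v t) := is_cderive_fpair p q z.
have vd : is_cderive v (fun t => z * v' t) := is_cderive_fpair p1 q1 z.
have wd : is_cderive w (fun t => z * v' t + (2^-1)%:C * (z * v t)).
  apply: is_cderive_eq
    (is_cderiveD vd (is_cderiveM (is_cderive_cst (2^-1)%:C) ud)) _ => t.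
  by rewrite mul0r add0r.
pose M := (n + m)%N.
have ode t : t%:C * (z * v' t) = M%:R%:C * v t - t%:C * (z * v t) + n%:R%:C * u t.
  have := fpair_kummer_op (t%:C * z) (padeP_op R n m) (padeQ_op R n m).
  rewrite /= -/p -/q -/p1 -/q1 -/(u t) -/(v t) -/(v' t) !rmorph_nat -/M.
  by move=> h; apply: subr0_eq; rewrite -[RHS]h; ring.
pose A t := Re (u t) * Re (w t) + Im (u t) * Im (w t).
pose dA t := Re (z * v t) * Re (w t) + Re (u t) * Re (z * v' t + (2^-1)%:C * (z * v t))
  + (Im (z * v t) * Im (w t) + Im (u t) * Im (z * v' t + (2^-1)%:C * (z * v t))).
have Ad t : is_derive t (1 : R) A (dA t).
  have [u1 u2] := ud t; have [w1 w2] := wd t.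
  exact: is_derive_funD (is_derive_funM u1 w1) (is_derive_funM u2 w2).
pose B t := ((n%:R - m%:R) / 2 + t * x / 4) * (Re (u t) ^+ 2 + Im (u t) ^+ 2)
  + t * x * (Re (w t) ^+ 2 + Im (w t) ^+ 2).
have AB t : t * dA t + t * x * A t - M%:R * A t = B t.
  have := ode t; rewrite /dA /A /B /w.
  move: (z * v' t) (u t) (v t) => zv [u1 u2] [v1 v2] odet.
  have o1 := congr1 (@complex.Re R) odet; have o2 := congr1 (@complex.Im R) odet.
  rewrite !(ReD, ImD, ReM, ImM, ReN, ImN) /= -/x -/y !mul0r !subr0 !addr0 in o1 o2 *.
  rewrite natrD in o1 o2 *.
  exact: kummer_flow_identity o1 o2.
pose F t := (t ^+ M)^-1 * (expR (t * x) * A t).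
pose dF t := expR (t * x) / t ^+ M / t * B t.
have Fd (t : R) : 0 < t -> is_derive t (1 : R) F (dF t).
  move=> t0; have t1 : t != 0 by rewrite gt_eqF.
  have lin : is_derive t (1 : R) (fun s : R => s * x) x.
    have h := is_derive_funM (is_derive_id t (1 : R)) (is_derive_cst x t (1 : R)).
    by apply: is_derive_eq h _; rewrite mul1r mulr0 addr0.
  have dE : is_derive t (1 : R) (fun s => expR (s * x)) (expR (t * x) * x).
    exact: is_derive1_comp (is_derive_expR _) lin.
  have tM : t ^+ M != 0 by rewrite expf_neq0.
  have dV := @is_deriveV R (fun s => s ^+ M) t _ 1 tM (is_derive_pow M t1).
  apply: is_derive_eq (is_derive_funM dV (is_derive_funM dE (Ad t))) _.
  rewrite /dF -AB /GRing.scale /=; field.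
  by rewrite t1 expf_neq0.
(* The terms in (n - m)/2 and |w|^2 are nonnegative; the one kept makes [B t = 0] force
   [u t = 0]. *)
have B0 (t : R) : 0 < t -> (Re (u t) ^+ 2 + Im (u t) ^+ 2) * (t * x / 4) <= B t.
  move=> t0; rewrite /B.
  have k0 : 0 <= (n%:R - m%:R) / 2 :> R.
    by rewrite divr_ge0// subr_ge0 ler_nat.
  have := sqr_ge0 (Re (u t)); have := sqr_ge0 (Im (u t)).
  have := sqr_ge0 (Re (w t)); have := sqr_ge0 (Im (w t)).
  have : 0 < t * x by rewrite mulr_gt0.
  move: (_ ^+ 2) (_ ^+ 2) (_ ^+ 2) (_ ^+ 2) (t * x) k0 => a1 a2 a3 a4 b k0.
  by move=> b0 h1 h2 h3 h4; nra.
have dF0 (t : R) : 0 < t -> 0 <= dF t.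
  move=> t0; rewrite mulr_ge0//.
    by rewrite !mulr_ge0 ?invr_ge0 ?exprn_ge0 ?expR_ge0 ?ltW.
  by rewrite (le_trans _ (B0 t t0))// mulr_ge0 ?addr_ge0 ?sqr_ge0 ?mulr_ge0 ?ltW.
have Fle (s t : R) : 0 < s -> s <= t -> F s <= F t.
  move=> s0 st; apply: (@is_derive_le _ F dF) => // r /andP[sr _].
    by apply: Fd; exact: lt_le_trans sr.
  by apply: dF0; exact: lt_le_trans sr.
have u1 : u 1 = 0 by rewrite /u rmorph1 mul1r.
have F1 : F 1 = 0 by rewrite /F /A u1 /= !mul0r addr0 !mulr0.
(* Orders M + 1 for f and M for f' make [A e] of order 2M + 1, which outweighs the singular factor
   e^(-M) in [F]. *)
have [cu cu0 hu] : exists2 c : R, 0 <= c & forall h, norm1 h <= norm1 z ->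
    norm1 (fpair p q h) <= c * norm1 h ^+ M.+1.
  by apply: norm1_fpair_jets => k kM; rewrite pade_jet_eq0// addn1.
have [cv cv0 hv] : exists2 c : R, 0 <= c & forall h, norm1 h <= norm1 z ->
    norm1 (fpair p1 q1 h) <= c * norm1 h ^+ M.
  apply: norm1_fpair_jets => k kM; rewrite -pair_jetS pade_jet_eq0//.
  by rewrite addn1 ltnS.
(* Monotonicity gives F e <= F s <= F 1 = 0 for all small e > 0, and - F e is at most a constant
   times e. *)
have F0 (s : R) : 0 < s -> s <= 1 -> F s = 0.
  move=> s0 s1; apply/eqP; rewrite eq_le -{1}F1 Fle//= -oppr_le0.
  pose r := norm1 z.
  apply: (@eq0_linear_bound _ (expR x * (cu * r ^+ M.+1 * (cv * r ^+ M + cu * r ^+ M.+1))) s s0).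
  move=> e e0 es; apply: (@le_trans _ _ (- F e)); first by rewrite lerN2 Fle.
  have e1 : e <= 1 := le_trans es s1.
  have nez : norm1 (e%:C * z) = e * r by rewrite norm1_realM gtr0_norm.
  have nezr : norm1 (e%:C * z) <= norm1 z.
    by rewrite nez ler_piMl// norm1_ge0.
  have ue := hu _ nezr; have ve := hv _ nezr; rewrite nez -/(u e) in ue.
  rewrite nez -/(v e) in ve.
  have er0 : 0 <= e * r by rewrite mulr_ge0 ?norm1_ge0// ltW.
  have we : norm1 (w e) <= e ^+ M * (cv * r ^+ M + cu * r ^+ M.+1).
    rewrite (le_trans (norm1D _ _))// [leRHS]mulrDr lerD//.
      by rewrite (le_trans ve)// exprMn mulrCA.
    rewrite norm1_realM (@le_trans _ _ (norm1 (u e)))//.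
      by rewrite ler_piMl ?norm1_ge0// ger0_norm ?invr_ge0// invf_le1// ler1n.
    rewrite (le_trans ue)// exprMn mulrCA ler_wpM2r//.
      by rewrite mulr_ge0// exprn_ge0// norm1_ge0.
    by rewrite exprS ler_piMl// exprn_ge0// ltW.
  have Ae : - A e <= norm1 (u e) * norm1 (w e).
    rewrite (le_trans (ler_norm _))// normrN (le_trans (ler_normD _ _))//.
    rewrite !normrM /norm1 mulrDl !mulrDr lerD//.
      by rewrite lerDl mulr_ge0.
    by rewrite lerDr mulr_ge0.
  have eM : 0 < e ^+ M by rewrite exprn_gt0.
  rewrite /F -mulrN -mulrN mulrC ler_pdivrMr//.
  apply: (@le_trans _ _ (expR x * (norm1 (u e) * norm1 (w e)))).
    apply: (@le_trans _ _ (expR (e * x) * (norm1 (u e) * norm1 (w e)))).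
      by rewrite ler_wpM2l// expR_ge0.
    rewrite ler_wpM2r//; first by rewrite mulr_ge0 ?norm1_ge0.
    by rewrite ler_expR ler_piMl// ltW.
  rewrite -!mulrA ler_wpM2l ?expR_ge0//.
  apply: (@le_trans _ _ (cu * (e * r) ^+ M.+1
      * (e ^+ M * (cv * r ^+ M + cu * r ^+ M.+1)))).
    by rewrite ler_pM ?norm1_ge0.
  set D := cv * _ + _; have D0 : 0 <= D.
    by rewrite addr_ge0 ?mulr_ge0 ?exprn_ge0 ?norm1_ge0.
  rewrite exprMn; have -> : cu * (e ^+ M.+1 * r ^+ M.+1) * (e ^+ M * D)
     = (cu * r ^+ M.+1 * D * e ^+ M) * e ^+ M.+1 by ring.
  have -> : cu * (r ^+ M.+1 * (D * (e * e ^+ M)))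
     = (cu * r ^+ M.+1 * D * e ^+ M) * e by ring.
  rewrite ler_wpM2l//.
    by rewrite !mulr_ge0 ?exprn_ge0 ?norm1_ge0// ltW.
  by rewrite exprS ler_piMr ?exprn_ile1// ltW.
have z0 : z != 0 by apply: contraTneq x0 => z0; rewrite /x z0 /= ltxx.
pose N := (n + m + 1)%N.
have [c c0 [b b0 h]] := fpair_taylor p q (norm1 z).
(* The leading Taylor term of f at z is nonzero; zeros of f near 0 on the ray will force it to be
   zero. *)
pose k := pair_jet p q N / N`!%:R * z ^+ N.
have k0 : k != 0.
  by rewrite /k pade_jet_lead !mulf_neq0 ?invr_eq0 ?factC_neq0 ?expf_neq0.
suff : norm1 k <= 0 by move/norm1_eq0/eqP; apply/negP.
apply: (@eq0_linear_bound _ (c * ((b * norm1 z) ^+ N.+1 / N.+1`!%:R)) 1 ltr01).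
move=> e e0 e1.
have e2 : e / 2 < e by rewrite ltr_pdivrMr// ltr_pMr// ltr1n.
have e20 : 0 < e / 2 by rewrite divr_gt0.
have Fdd r : e / 2 <= r -> is_derive r (1 : R) F (dF r).
  by move=> er; apply: Fd; exact: lt_le_trans er.
(* As F vanishes at e/2 and e, some s between them has [dF s = 0], hence [B s = 0] and f(s z) =
   0. *)
have [||s] := @MVT R F dF (e / 2) e e2.
- by move=> r; rewrite in_itv /= => /andP[er _]; apply: Fdd; exact: ltW.
- apply: derivable_within_continuous => r; rewrite in_itv /= => /andP[er _].
  by have [] := Fdd r er.
rewrite in_itv /= => /andP[es se].
have s0 : 0 < s by exact: lt_trans es.
have s1 : s <= 1 by rewrite (le_trans (ltW se)).
rewrite !F0 ?(ltW e2) ?(le_trans (ltW e2) e1)// subrr => /esym/eqP.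
rewrite mulf_eq0 subr_eq0 [e == _]gt_eqF// orbF /dF !mulf_eq0.
rewrite !invr_eq0 gt_eqF ?expR_gt0// gt_eqF ?exprn_gt0// gt_eqF//= => /eqP Bs.
have us : u s = 0.
  have := B0 s s0; rewrite Bs pmulr_lle0; last by rewrite divr_gt0// mulr_gt0.
  have := sqr_ge0 (Re (u s)); have := sqr_ge0 (Im (u s)) => h1 h2 h3.
  by apply: complex_eq => /=; apply/eqP; rewrite -sqrf_eq0 eq_le;
     apply/andP; split=> //; lra.
have ns : norm1 (s%:C * z) = s * norm1 z by rewrite norm1_realM gtr0_norm.
(* Since f(s z) = 0, the remainder bounds the leading term s^N k alone; cancelling s^N leaves
   [norm1 k] at most a constant times s <= e. *)
have := h N.+1 (s%:C * z); rewrite ns => /(_ _)/wrap[].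
  by rewrite ler_piMl// norm1_ge0.
rewrite -/(u s) us sub0r norm1N big_ord_recr /= big1 ?add0r => [|i _]; last first.
  by rewrite pade_jet_eq0 ?mul0r.
have -> : pair_jet p q N / N`!%:R * (s%:C * z) ^+ N = s%:C ^+ N * k.
  by rewrite /k exprMn; ring.
rewrite -rmorphXn norm1_realM ger0_norm; last by rewrite exprn_ge0// ltW.
have -> : c * ((b * (s * norm1 z)) ^+ N.+1 / N.+1`!%:R) =
   s ^+ N * (c * ((b * norm1 z) ^+ N.+1 / N.+1`!%:R) * s).
  by rewrite !exprMn [s ^+ N.+1]exprS; ring.
rewrite ler_pM2l ?exprn_gt0// => /le_trans; apply.
apply: ler_wpM2l; last exact: ltW.
by rewrite !mulr_ge0 ?invr_ge0 ?exprn_ge0 ?mulr_ge0 ?norm1_ge0.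
Qed.

End Rightmost.
Theorem theorem3p1 (R : realType) (n m : nat) (tau : R) (tau_gt0 : 0 < tau)
    (a : 'I_n -> R) (alpha : 'I_m.+1 -> R) (s0 : R) :
  [<-> (* a *)
       zero_of_order (Delta tau a alpha) s0%:C (n + m + 1);
       (* b *)
       is_pade m n (@cexp R) (- Qtilde n tau s0 alpha) (Ptilde tau s0 a);
       (* c *)
       forall z : R[i],
         Deltatilde tau s0 a alpha z =
         n`!%:R * z ^+ (n + m + 1) / ((n + m + 1)`!)%:R
         * kummer (m + 1)%:R (n + m + 2)%:R (- z);
       (* d *)
       (forall k : 'I_n,
          a k = (-1) ^+ (n - k) * n`!%:R *
            \sum_(k <= j < n.+1)
              'C(j, k)%:R * 'C(m + n - j, m)%:R * s0 ^+ (j - k)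
              / (j`!%:R * tau ^+ (n - j))) /\
       (forall k : 'I_m.+1,
          alpha k = (-1) ^ (n%:Z - 1) * expR (s0 * tau) *
            \sum_(k <= j < m.+1)
              (-1) ^+ (j - k) * ((m + n - j)`!)%:R * s0 ^+ (j - k)
              / (k`!%:R * ((j - k)`!)%:R * ((m - j)`!)%:R
                 * tau ^ (n%:Z - j%:Z)))]
  /\
  (zero_of_order (Delta tau a alpha) s0%:C (n + m + 1) -> (m <= n)%N ->
   forall s : R[i],
     Delta tau a alpha s = 0 -> complex.Re s <= complex.Re s0%:C).
Proof.
set P := Ptilde tau s0 a; set Q := Qtilde n tau s0 alpha.
have jets := pade_jets s0 tau_gt0 a alpha; rewrite -/P -/Q in jets.
have t0 := tauC_neq0 tau_gt0.
have aJ : zero_of_order (Delta tau a alpha) s0%:C (n + m + 1) ->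
    P = padeP R n m /\ Q = padeQ R n m.
  move=> [d0 _]; apply/jets => k kN; have /eqP := d0 k kN.
  rewrite derive1n_Delta// !mulf_eq0 invr_eq0 !expf_eq0 (negPf t0) !andbF /=.
  by move/eqP.
have f_eq z : Deltatilde tau s0 a alpha z = fpair P Q z := Deltatilde_fpair s0 tau_gt0 a alpha z.
split; last first.
  move=> /aJ[PE QE] mn s; rewrite (Delta_fpair s0 tau_gt0) -/P -/Q => /eqP.
  rewrite mulf_eq0 invr_eq0 expf_eq0 (negPf t0) andbF /= PE QE => /eqP.
  (* A root s corresponds to z = tau (s - s0), and tau > 0 carries the sign of Re z over to Re s -
     s0. *)
  move/(pade_root_Re mn); rewrite ReM ReD ReN /= mul0r subr0 pmulr_rle0//.
  by rewrite subr_le0.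
tfae.
- move=> /aJ[PE QE]; split.
  + rewrite size_polyN (leq_trans (size_scale_comp_rescale _ _ _ _)) ?size_polyQ//.
  + by rewrite (leq_trans (size_scale_comp_rescale _ _ _ _)) ?(polyP_monic a).2.
  have [c c0 h] := @norm1_fpair_jets R P Q (n + m + 1) 1
    (jets.2 (conj PE QE)).
  apply: (@bigO_le_norm1 _ _ _ (2 * expR 1 * c)) => z z1.
  (* The Pade error and f differ by an exponential factor, bounded near 0 together with its
     inverse. *)
  have -> : P.[z] * cexp z - (- Q).[z] = cexp z * fpair P Q z.
    rewrite /fpair hornerN mulrDr mulrA -cexpD subrr cexp0; ring.
  rewrite (le_trans (norm1M _ _))// -mulrA ler_pM ?norm1_ge0 ?h//.
  by rewrite (le_trans (norm1_cexp _))// ler_wpM2l// ler_expR.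
- move=> [_ _ /bigO_norm1_le[c [d [d0 h]]]] z.
  suff [PE QE] : P = padeP R n m /\ Q = padeQ R n m.
    by rewrite f_eq PE QE fpair_pade_kummer.
  apply/jets.
  apply: (@jet_eq0 _ _ _ _ (2 * expR d * c) d d0) => w wd.
  have -> : fpair P Q w = cexp (- w) * (P.[w] * cexp w - (- Q).[w]).
    rewrite hornerN opprK mulrDr mulrCA -cexpD addNr cexp0 mulr1 /fpair; ring.
  rewrite (le_trans (norm1M _ _))// -mulrA ler_pM ?norm1_ge0 ?h//.
  by rewrite (le_trans (norm1_cexp _))// norm1N ler_wpM2l// ler_expR.
- move=> hc.
  suff [PE QE] : P = padeP R n m /\ Q = padeQ R n m.
    by split; [apply/(padeP_coefs m s0 tau_gt0)|apply/(padeQ_coefs n s0 tau_gt0)].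
  apply/jets => k kN.
  (* The explicit pair also satisfies (c), so the difference of the pairs is the zero function and
     the constant 0 serves in [jet_eq0]. *)
  rewrite -[LHS]subr0 -[X in _ - X](pade_jet_eq0 R kN) -pair_jetB.
  apply: (@jet_eq0 _ _ _ _ 0 1 ltr01 _ _ kN) => z _.
  by rewrite fpairB -f_eq hc fpair_pade_kummer subrr norm1_0 mul0r.
- move=> [ha hb].
  have PE : P = padeP R n m by apply/(padeP_coefs m s0 tau_gt0).
  have QE : Q = padeQ R n m by apply/(padeQ_coefs n s0 tau_gt0).
  split=> [k kN|]; rewrite derive1n_Delta// -/P -/Q PE QE.
    by rewrite pade_jet_eq0// mulr0.
  by rewrite pade_jet_lead !mulf_neq0 ?invr_eq0 ?expf_neq0 ?factC_neq0.
Qed.
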